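(* Let $n\ge2$, let $\nu\ge4$ be even, let $a>0$, and suppose $$F(q,p,\mathbf u)=S(q,p,\mathbf u)+d(p,\mathbf u)\,\mathcal C_{\nu,a}(q,\mathbf u)$$ for $(q,p,\mathbf u)$ near $(0,0,0)\in\mathbb R\times\mathbb R^m\times\mathbb R^{\nu-2}$, where $S$ is jointly $C^{n+1}$, $d$ is jointly $C^2$, and $$\partial_q^jS(0,0,0)=0\ (0\le j<n),\qquad c=\frac{\partial_q^nS(0,0,0)}{n!}\ne0,\qquad d_0=d(0,0)\ne0.$$ Then $$\operatorname{Cyc}_{(0,0,0)}(F)\le\begin{cases}n,&cd_0>0,\\ n+1,&cd_0<0.\end{cases}$$ If the central coefficient map $$p\longmapsto\left(S(0,p,0),\partial_qS(0,p,0),\dots,\frac{\partial_q^{n-1}S(0,p,0)}{(n-1)!}\right)$$ has rank $n$ at $p=0$, the applicable bound is attained on $\mathbf u=0$. The upper bound is uniform across the complete exact cap unfolding (all $\mathbf u$ near $0$).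
   Context: $x_+=\max\{x,0\}$. For $\mathbf u=(u_1,\dots,u_{\nu-2})$, $$\mathcal C_{\nu,a}(q,\mathbf u)=\int_{\mathbb R}\Bigl(q-at^\nu-\sum_{j=1}^{\nu-2}u_jt^j\Bigr)_+dt.$$ Local cyclicity, with parameter $\lambda=(p,\mathbf u)$: fix a representative of $F$ on $(-\rho_*,\rho_* )\times V_*$; for an interval $U$ let $N_{\mathrm{iso}}(F(\cdot,\lambda);U)\in\mathbb N_0\cup\{\infty\}$ be the number of distinct isolated real zeros of $q\mapsto F(q,\lambda)$ in $U$; then $\operatorname{Cyc}_{(0,0,0)}(F)=\inf_{0<\rho\le\rho_*,\,0\in V\subset V_*}\sup_{\lambda\in V}N_{\mathrm{iso}}(F(\cdot,\lambda);(-\rho,\rho))$, with $V$ ranging over parameter neighbourhoods of $0$. ''Attained on $\mathbf u=0$'' means that in every neighbourhood of the origin there are parameters $(p,0)$ for which $F(\cdot,p,0)$ has the stated number of isolated zeros near $q=0$. *)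

(* Defs.v *)
From mathcomp Require Import all_boot all_order all_algebra.
From mathcomp Require Import all_classical all_reals all_analysis.

Set Implicit Arguments.
Unset Strict Implicit.
Unset Printing Implicit Defensive.

Import Order.TTheory GRing.Theory Num.Theory.
Import numFieldNormedType.Exports.

Local Open Scope classical_set_scope.
Local Open Scope ring_scope.

(* [U] is meant to be open and [V] finite-dimensional: there, [f] is C^(k+1)
   iff it is Frechet differentiable and [x |-> 'd f x] is C^k, and the latter
   holds iff each directional derivative ['D_v f] is C^k. *)
Fixpoint Ck (R : realType) (V W : normedModType R) (k : nat) (U : set V)
    (f : V -> W) : Prop :=
  match k with
  | 0 => {in U, continuous f}
  | k'.+1 => {in U, forall x, differentiable f x} /\
             forall v : V, Ck k' U ('D_v f)
  end.

Definition Ck_near (R : realType) (V W : normedModType R) (k : nat) (x : V)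
    (f : V -> W) : Prop :=
  exists2 U : set V, open_nbhs x U & Ck k U f.

(* Coordinates are numbered from 0, so [u 0 j] is u_(j+1), the coefficient of
   t^(j+1). *)
Definition cap (R : realType) (nu : nat) (a q : R) (u : 'rV[R]_(nu - 2)) : R :=
  \int[@lebesgue_measure R]_t
    Num.max (q - a * t ^+ nu - \sum_(j < nu - 2) u 0 j * t ^+ j.+1) 0.
Arguments cap {R} nu a q u.

Definition dq (R : realType) (L : normedModType R) (j : nat)
    (S : R * L -> R) (l : L) : R :=
  derive1n j (fun q : R => S (q, l)) 0.

Definition central_coeffs (R : realType) (m k n : nat)
    (S : R * ('rV[R]_m * 'rV[R]_k) -> R) (p : 'rV[R]_m) : 'rV[R]_n :=
  \row_(j < n) (dq j S (p, 0) / j`!%:R).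

(* Valued in \bar R, where [counting] is +oo on infinite sets. *)
Definition Niso (R : realType) (f : R -> R) (U : set R) : \bar R :=
  counting (isolated [set q | U q /\ f q = 0]).

(* The representative of the germ is the restriction of [F] to
   ]-rho0, rho0[ x V0; values outside this set are irrelevant. *)
Definition Cyc (R : realType) (L : normedModType R) (rho0 : R) (V0 : set L)
    (F : R -> L -> R) : \bar R :=
  ereal_inf [set x | exists (rho : R) (V : set L),
    [/\ 0 < rho <= rho0, nbhs 0 V, V `<=` V0 &
        x = ereal_sup [set Niso (F ^~ l) `]-rho, rho[ | l in V]]].

(* "Near q = 0" means in ]-rho, rho[ for every small enough rho: on a large
   interval the representative may have additional zeros away from q = 0. *)
Definition attained_on_central (R : realType) (m k : nat)
    (F : R -> 'rV[R]_m * 'rV[R]_k -> R) (N : nat) : Prop :=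
  \forall rho \near (0 : R)^'+,
    forall V : set ('rV[R]_m * 'rV[R]_k),
      nbhs (0 : 'rV[R]_m * 'rV[R]_k) V ->
      exists2 p : 'rV[R]_m, V (p, 0) &
        Niso (F ^~ (p, 0)) `]-rho, rho[ = N%:R%:E.

(* Main.v *)
From HB Require Import structures.
Require Import Defs.
From mathcomp Require Import all_boot all_order all_algebra.
From mathcomp Require Import all_classical all_reals all_analysis.
From mathcomp Require Import measurable_realfun finmap ring lra zify.

Import Order.TTheory GRing.Theory Num.Theory.
Import numFieldNormedType.Exports.

Local Open Scope classical_set_scope.
Local Open Scope ring_scope.

(** Let P be the potential a t^nu + sum_j u_j t^j, and let m(q) be the length of
    the sublevel set {P < q}.  The cap integral has derivative m in q
    ([is_derive_cap]), so F' = S' + d m.  Everything rests on two facts.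

    First, m vanishes up to the minimum of P and increases at a rate of at least
    1/eps afterwards, where eps is a Lipschitz constant of P on the interval
    outside of which P exceeds all levels considered ([sublength_steep]).  For
    nu >= 2 and small u this interval can be taken so short that eps is as
    small as desired, uniformly in u ([flat_confining_wells]).  Hence d m grows
    faster than S', whose derivative is bounded, and F' is strictly monotone
    where m > 0.  In this way the higher derivatives of the cap integral, which
    are singular at the critical values of P, never enter.

    Second, the n-th derivative of S has the sign of c.  So if S' has n - 1
    zeros, then c S' > 0 to the right of the last one ([pos_right_of_zeros]).

    Upper bound.  Between N + 1 zeros of F there are N zeros of F', and by the
    first fact m vanishes at all of them except possibly the last, so that the
    first N - 1 are zeros of S'.  By the second fact S' has at most n - 1 zeros,
    whence N <= n.  If c d > 0, then N = n is impossible too: at the n-th zero of F',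
    to the right of n - 1 zeros of S', both S' and d m would have to cancel while
    c S' > 0 and c d m >= 0.  Thus F has at most n + 1 zeros in general, and at
    most n if c d > 0 ([cap_zero_bound]).

    Sharpness.  For u = 0 the cap integral vanishes for q <= 0, and there F = S.
    Since the central coefficient map is a submersion, it is onto a neighbourhood
    of 0 ([central_surjection]), and p can be chosen arbitrarily small so that the
    Taylor polynomial of S of degree n - 1 is the truncation of
    c (q + e) (q + 2 e) ... (q + n e).  The remainder differs from c q^n by at
    most eta |q|^n, where eta depends neither on e nor on p, so that S keeps the
    n sign changes of this product ([comb_oscillation]).  If c d < 0, one more
    sign change occurs on q > 0, because for small q the cap integral exceeds any
    given multiple of q^2 ([cap0_superquadratic], [cap_dominates]). *)

Set Implicit Arguments.
Unset Strict Implicit.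
Unset Printing Implicit Defensive.

(** * Zeros and derivatives of a function of one variable *)

Lemma incr_le (R : realType) (k : nat) (x : nat -> R) :
  (forall i, (i < k)%N -> x i < x i.+1) ->
  forall i j, (i <= j)%N -> (j <= k)%N -> x i <= x j.
Proof.
move=> xS i; elim=> [|j IH]; first by rewrite leqn0 => /eqP ->.
rewrite leq_eqVlt => /predU1P[->//|ij] jk.
exact: le_trans (IH ij (ltnW jk)) (ltW (xS _ jk)).
Qed.

Lemma MVT_within (R : realType) (a b : R) (f f' : R -> R) (x y : R) :
  (forall z, z \in `]a, b[ -> is_derive z 1 f (f' z)) ->
  x \in `]a, b[ -> y \in `]a, b[ -> x < y ->
  exists2 z, z \in `]x, y[ & f y - f x = f' z * (y - x).
Proof.
move=> fd; rewrite !in_itv/= => /andP[ax xb] /andP[ay yb] xy.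
have d1 z : z \in `]x, y[ -> is_derive z 1 f (f' z).
  rewrite in_itv/= => /andP[xz zy]; apply: fd.
  by rewrite in_itv/=; apply/andP; split; lra.
have cf : {within `[x, y], continuous f}.
  apply: derivable_within_continuous => z; rewrite in_itv/= => /andP[xz zy].
  by apply: ex_derive; apply: fd; rewrite in_itv/=; apply/andP; split; lra.
exact: (MVT xy d1 cf).
Qed.

Lemma Rolle_seq (R : realType) (a b : R) (f f' : R -> R) (k : nat)
    (x : nat -> R) :
  (forall z, z \in `]a, b[ -> is_derive z 1 f (f' z)) ->
  (forall i, (i <= k)%N -> x i \in `]a, b[) ->
  (forall i, (i < k)%N -> x i < x i.+1) ->
  (forall i, (i <= k)%N -> f (x i) = 0) ->
  exists y : nat -> R, forall i, (i < k)%N ->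
    [/\ x i < y i, y i < x i.+1 & f' (y i) = 0].
Proof.
move=> fd xI xS f0.
suff /choice[y yP] : forall i, exists y, (i < k)%N ->
  [/\ x i < y, y < x i.+1 & f' y = 0] by exists y.
move=> i; have [ik|] := boolP (i < k)%N; last by exists 0.
have [z zI] := MVT_within fd (xI _ (ltnW ik)) (xI _ ik) (xS _ ik).
rewrite !f0 ?(ltnW ik)// subrr => /esym/eqP.
rewrite mulf_eq0 subr_eq0 (gt_eqF (xS _ ik)) orbF => /eqP f'z.
by exists z => _; move: zI; rewrite in_itv/= => /andP[].
Qed.

(** By Rolle, k zeros of f leave k - 1 zeros of f', to the right of which f' is
    positive by induction; so f increases from its last zero on.  With the point
    [y] taken as one more zero, this also says that f has at most k zeros. *)
Lemma pos_right_of_zeros (R : realType) (a b : R) (k : nat) :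
  forall (f : nat -> R -> R) (x : nat -> R) (y : R),
  (forall j, (j < k)%N -> forall z, z \in `]a, b[ ->
     is_derive z 1 (f j) (f j.+1 z)) ->
  (forall z, z \in `]a, b[ -> 0 < f k z) ->
  (forall i, (i < k)%N -> x i \in `]a, b[) ->
  (forall i, (i.+1 < k)%N -> x i < x i.+1) ->
  (forall i, (i < k)%N -> f 0%N (x i) = 0) ->
  (forall i, (i < k)%N -> x i < y) ->
  y \in `]a, b[ -> 0 < f 0%N y.
Proof.
elim: k => [|k IH] f x y fd fpos xI xS f0 xy yI; first exact: fpos.
have [w wP] := Rolle_seq (fd 0%N isT) xI xS f0.
have xk i : (i <= k)%N -> x i <= x k by move=> ik; apply: incr_le ik (leqnn k).
have f1 z : z \in `]a, b[ -> x k <= z -> 0 < f 1%N z.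
  move=> zI xkz; apply: (IH (fun j => f j.+1) w) => //.
  - by move=> j jk; apply: fd.
  - move=> i ik; have [xw wx _] := wP _ ik.
    move: (xI i (ltnW ik)) (xI i.+1 ik); rewrite !in_itv/= => /andP[? ?] /andP[? ?].
    by apply/andP; split; lra.
  - move=> i ik; have [_ wx _] := wP i (ltnW ik); have [xw _ _] := wP _ ik.
    exact: lt_trans wx xw.
  - by move=> i ik; have [] := wP _ ik.
  - move=> i ik; have [_ wx _] := wP _ ik.
    by apply: lt_le_trans wx _; apply: le_trans xkz; apply: xk.
have [z] := MVT_within (fd 0%N isT) (xI k (ltnSn k)) yI (xy k (ltnSn k)).
rewrite in_itv/= => /andP[xz zy]; rewrite f0// subr0 => ->.
apply: mulr_gt0; last by rewrite subr_gt0 xy.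
apply: f1; last exact: ltW.
move: (xI k (ltnSn k)) yI; rewrite !in_itv/= => /andP[? ?] /andP[? ?].
by apply/andP; split; lra.
Qed.

(** Where [m] is positive, F' = f1 + dl m is strictly increasing by [steep], and
    two consecutive zeros of F' cannot both lie there.  As [m] is nondecreasing,
    it therefore vanishes at every zero of F' but the last one. *)
Lemma zeros_below_steep_part (R : realType) (a b dl : R) (f1 m F : R -> R) (N : nat)
    (x : nat -> R) :
  (forall z, z \in `]a, b[ -> is_derive z 1 F (f1 z + dl * m z)) ->
  (forall z, 0 <= m z) ->
  (forall y z, y <= z -> m y <= m z) ->
  (forall y z, y \in `]a, b[ -> z \in `]a, b[ -> y < z -> 0 < m y ->
     f1 y - f1 z < dl * (m z - m y)) ->
  (forall i, (i <= N.+2)%N -> x i \in `]a, b[) ->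
  (forall i, (i < N.+2)%N -> x i < x i.+1) ->
  (forall i, (i <= N.+2)%N -> F (x i) = 0) ->
  exists y : nat -> R,
    [/\ forall i, (i < N.+2)%N -> y i \in `]a, b[,
        forall i, (i < N.+1)%N -> y i < y i.+1,
        forall i, (i < N.+2)%N -> f1 (y i) + dl * m (y i) = 0 &
        forall i, (i < N.+1)%N -> f1 (y i) = 0].
Proof.
move=> Fd m_ge0 m_nd steep xI xS F0.
have [y yP] := Rolle_seq Fd xI xS F0.
have yI i : (i < N.+2)%N -> y i \in `]a, b[.
  move=> ik; have [xw wx _] := yP _ ik.
  move: (xI i (ltnW ik)) (xI i.+1 ik); rewrite !in_itv/= => /andP[? ?] /andP[? ?].
  by apply/andP; split; lra.
have yS i : (i < N.+1)%N -> y i < y i.+1.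
  move=> iN; have [_ wx _] := yP i (ltnW iN).
  by have [xw _ _] := yP i.+1 iN; exact: lt_trans wx xw.
exists y; split => //; first by move=> i /yP[].
suff mN : m (y N) = 0.
  move=> i iN; have [_ _] := yP _ (ltnW iN).
  suff -> : m (y i) = 0 by rewrite mulr0 addr0.
  apply/le_anti/andP; split => //; rewrite -mN; apply: m_nd.
  by apply: (incr_le yS).
apply/eqP; rewrite eq_le m_ge0 andbT leNgt; apply/negP => mN.
have := steep _ _ (yI N (ltnW (ltnSn _))) (yI N.+1 (ltnSn _)) (yS _ (ltnSn _)) mN.
have [_ _ e1] := yP N (ltnW (ltnSn _)).
have [_ _ e2] := yP N.+1 (ltnSn _).
by rewrite mulrBr; lra.
Qed.

(** The n - 1 zeros of [f 1] force [f 1] to be positive at the last zero of F',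
    where F' would then be positive. *)
Lemma no_extra_zero_same_sign (R : realType) (a b dl : R) (f : nat -> R -> R)
    (m F : R -> R) (n : nat) (x : nat -> R) :
  (2 <= n)%N -> 0 < dl ->
  (forall j, (0 < j < n)%N -> forall z, z \in `]a, b[ ->
     is_derive z 1 (f j) (f j.+1 z)) ->
  (forall z, z \in `]a, b[ -> is_derive z 1 F (f 1%N z + dl * m z)) ->
  (forall z, 0 <= m z) ->
  (forall y z, y <= z -> m y <= m z) ->
  (forall y z, y \in `]a, b[ -> z \in `]a, b[ -> y < z -> 0 < m y ->
     f 1%N y - f 1%N z < dl * (m z - m y)) ->
  (forall z, z \in `]a, b[ -> 0 < f n z) ->
  (forall i, (i <= n)%N -> x i \in `]a, b[) ->
  (forall i, (i < n)%N -> x i < x i.+1) ->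
  (forall i, (i <= n)%N -> F (x i) = 0) -> False.
Proof.
case: n => [//|[//|n]] _ dl0 fd Fd m0 mnd st fpos xI xS F0.
have [y [yI yS F'0 f10]] := zeros_below_steep_part Fd m0 mnd st xI xS F0.
have : 0 < f 1%N (y n.+1).
  apply: (@pos_right_of_zeros R a b n.+1 (fun j => f j.+1) y) => //.
  - by move=> j jn; apply: fd.
  - by move=> i iN; apply: yI; exact: ltnW.
  - by move=> i iN; apply: yS; exact: ltnW.
  - move=> i iN; apply: (@le_lt_trans _ _ (y n)); last exact: yS.
    by apply: (incr_le yS) => //.
  - exact: yI.
have := F'0 n.+1 (ltnSn _); have := mulr_ge0 (ltW dl0) (m0 (y n.+1)); lra.
Qed.

(** Here the last zero of F' carries no information, but one more zero of F is
    given, hence one more zero of [f 1] than its (n - 1)-th derivative allows. *)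
Lemma no_extra_zero_opposite_sign (R : realType) (a b dl : R) (f : nat -> R -> R)
    (m F : R -> R) (n : nat) (x : nat -> R) :
  (2 <= n)%N ->
  (forall j, (0 < j < n)%N -> forall z, z \in `]a, b[ ->
     is_derive z 1 (f j) (f j.+1 z)) ->
  (forall z, z \in `]a, b[ -> is_derive z 1 F (f 1%N z + dl * m z)) ->
  (forall z, 0 <= m z) ->
  (forall y z, y <= z -> m y <= m z) ->
  (forall y z, y \in `]a, b[ -> z \in `]a, b[ -> y < z -> 0 < m y ->
     f 1%N y - f 1%N z < dl * (m z - m y)) ->
  (forall z, z \in `]a, b[ -> f n z < 0) ->
  (forall i, (i <= n.+1)%N -> x i \in `]a, b[) ->
  (forall i, (i < n.+1)%N -> x i < x i.+1) ->
  (forall i, (i <= n.+1)%N -> F (x i) = 0) -> False.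
Proof.
case: n => [//|[//|n]] _ fd Fd m0 mnd st fneg xI xS F0.
have [y [yI yS F'0 f10]] := zeros_below_steep_part Fd m0 mnd st xI xS F0.
have : 0 < - f 1%N (y n.+1).
  apply: (@pos_right_of_zeros R a b n.+1 (fun j z => - f j.+1 z) y) => //.
  - by move=> j jn z zI; have := fd j.+1 jn z zI => ?; apply: is_deriveN.
  - by move=> z zI; rewrite oppr_gt0 fneg.
  - by move=> i iN; apply: yI; do 2 apply: ltnW.
  - by move=> i iN; apply: yS; do 2 apply: ltnW.
  - by move=> i iN; rewrite f10 ?oppr0//; exact: ltnW.
  - move=> i iN; apply: (@le_lt_trans _ _ (y n)); last by apply: yS; exact: ltnW.
    by apply: (incr_le yS) => //; do 2 apply: ltnW.
  - by apply: yI; exact: ltnW.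
by rewrite f10// oppr0 ltxx.
Qed.

Lemma sign_changes (R : realType) (a b : R) (f : R -> R) (N : nat)
    (z : nat -> R) :
  (forall t, t \in `]a, b[ -> derivable f t 1) ->
  (forall i, (i <= N)%N -> z i \in `]a, b[) ->
  (forall i, (i < N)%N -> z i < z i.+1) ->
  (forall i, (i < N)%N -> f (z i) * f (z i.+1) < 0) ->
  exists x : nat -> R,
    [/\ forall i, (i < N)%N -> x i \in `]a, b[,
        forall i, (i.+1 < N)%N -> x i < x i.+1 &
        forall i, (i < N)%N -> f (x i) = 0].
Proof.
move=> fd zI zS fz.
have /choice[x xP] : forall i, exists y, (i < N)%N ->
    [/\ z i < y, y < z i.+1 & f y = 0].
  move=> i; have [iN|] := boolP (i < N)%N; last by exists 0.
  have zz := zS _ iN; have s := fz _ iN.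
  move: (zI i (ltnW iN)) (zI i.+1 iN); rewrite !in_itv/= => /andP[? ?] /andP[? ?].
  have [||y] := @IVT R f (z i) (z i.+1) 0 (ltW zz).
  - apply: derivable_within_continuous => t; rewrite in_itv/= => /andP[? ?].
    by apply: fd; rewrite in_itv/=; apply/andP; split; lra.
  - by rewrite ge_min le_max; apply/andP; split; apply/orP;
      case: (lerP (f (z i)) 0) => ?; [left|right|right|left]; nra.
  rewrite in_itv/= => /andP[zy yz] fy0; exists y => _; split => //.
    rewrite lt_neqAle zy andbT; apply/eqP => zy'.
    by move: s; rewrite zy' fy0 mul0r ltxx.
  rewrite lt_neqAle yz andbT; apply/eqP => yz'.
  by move: s; rewrite -yz' fy0 mulr0 ltxx.
exists x; split.
- move=> i iN; have [? ? _] := xP _ iN.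
  move: (zI i (ltnW iN)) (zI i.+1 iN); rewrite !in_itv/= => /andP[? ?] /andP[? ?].
  by apply/andP; split; lra.
- move=> i iN; have [_ ? _] := xP i (ltnW iN); have [? _ _] := xP _ iN.
  lra.
- by move=> i /xP[].
Qed.

(** Sorting turns any N + 1 elements of [A] into an increasing chain; it thus
    suffices to refute such chains, a form suited to Rolle's theorem. *)
Lemma finite_of_bounded_chains (R : realType) (A : set R) (N : nat) :
  (forall x : nat -> R, (forall i, (i <= N)%N -> A (x i)) ->
     (forall i, (i < N)%N -> x i < x i.+1) -> False) ->
  finite_set A /\ (#|` fset_set A | <= N)%N.
Proof.
move=> noA.
have noB (B : {fset R}) : [set` B] `<=` A -> (#|` B | <= N)%N.
  move=> BA; rewrite leqNgt; apply/negP => NB.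
  pose s := sort <=%R (enum_fset B).
  have ss : size s = #|` B | by rewrite size_sort.
  have srt : sorted <%R s.
    by rewrite lt_sorted_uniq_le sort_uniq fset_uniq sort_le_sorted.
  apply: (noA (nth 0 s)).
    move=> i iN; apply: BA => /=.
    have : nth 0 s i \in s by apply: mem_nth; rewrite ss; exact: leq_ltn_trans NB.
    by rewrite mem_sort.
  move=> i iN; have -> : (nth 0 s i < nth 0 s i.+1) = (i < i.+1)%N.
    by apply: lt_sorted_ltn_nth => //; rewrite inE ss; lia.
  by [].
have finA : finite_set A.
  apply: contrapT => /(@infinite_set_fset _ _ N.+1)[B BA]; rewrite leqNgt => /negP; apply.
  by rewrite ltnS; exact: noB.
by split => //; apply: noB; rewrite fset_setK.
Qed.

Lemma counting_le (R : realType) (A : set R) (N : nat) :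
  finite_set A -> (#|` fset_set A | <= N)%N -> (counting A <= N%:R%:E :> \bar R)%E.
Proof. by move=> fA AN; rewrite /counting asboolT// lee_fin ler_nat. Qed.

Lemma isolated_finite (R : realType) (A : set R) :
  finite_set A -> isolated A = A.
Proof.
move=> fA; apply/seteqP; split; first exact: isolatedS.
move=> x Ax; split; first exact: mem_set.
exists (~` (A `\ x)); last first.
  apply/seteqP; split => y /=; first by move=> [+ Ay] => /not_andP[//|/contrapT].
  by move=> ->; split => // -[_]; apply.
apply: open_nbhs_nbhs; split; last by move=> -[_]; apply.
apply: closed_openC; apply: (@accessible_finite_set_closed R).1.
  by apply: hausdorff_accessible; exact: Rhausdorff.
exact: finite_setD.
Qed.

Lemma Niso_le (R : realType) (f : R -> R) (U : set R) (N : nat) :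
  (forall x : nat -> R, (forall i, (i <= N)%N -> U (x i)) ->
     (forall i, (i < N)%N -> x i < x i.+1) ->
     (forall i, (i <= N)%N -> f (x i) = 0) -> False) ->
  finite_set [set q | U q /\ f q = 0] /\ (Niso f U <= N%:R%:E)%E.
Proof.
move=> noZ; have [|fZ ZN] := @finite_of_bounded_chains _ [set q | U q /\ f q = 0] N.
  by move=> x xZ xS; apply: (noZ x) => // i /xZ[].
by split => //; rewrite /Niso isolated_finite//; exact: counting_le.
Qed.

Lemma Niso_eq (R : realType) (f : R -> R) (U : set R) (N : nat) (x : nat -> R) :
  (Niso f U <= N%:R%:E)%E -> finite_set [set q | U q /\ f q = 0] ->
  (forall i, (i < N)%N -> U (x i)) ->
  (forall i, (i.+1 < N)%N -> x i < x i.+1) ->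
  (forall i, (i < N)%N -> f (x i) = 0) -> Niso f U = N%:R%:E.
Proof.
move=> NN fZ xU xS x0; apply/le_anti/andP; split => //.
rewrite /Niso isolated_finite// /counting asboolT// lee_fin ler_nat.
have xi : {in iota 0 N &, injective x}.
  move=> i j; rewrite !mem_iota /= add0n => iN jN xij.
  have xlt k l : (k < l)%N -> (l < N)%N -> x k < x l.
    move=> kl lN; apply: (@lt_le_trans _ _ (x k.+1)).
      by apply: xS; exact: leq_ltn_trans lN.
    by apply: (@incr_le _ N.-1 x) => //; [move=> o oN; apply: xS|]; lia.
  have [lt_|lt_|//] := ltngtP i j.
    by have := xlt _ _ lt_ jN; rewrite xij ltxx.
  by have := xlt _ _ lt_ iN; rewrite xij ltxx.
have uniqx : uniq [seq x i | i <- iota 0 N] by rewrite map_inj_in_uniq ?iota_uniq.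
have subx : {subset [seq x i | i <- iota 0 N] <=
    enum_fset (fset_set [set q | U q /\ f q = 0])}.
  move=> _ /mapP[i + ->]; rewrite mem_iota /= add0n => iN.
  suff : x i \in fset_set [set q | U q /\ f q = 0] by [].
  by rewrite in_fset_set//; apply/mem_set; split; [exact: xU|exact: x0].
by have := uniq_leq_size uniqx subx; rewrite size_map size_iota.
Qed.

(** * The area of a one-dimensional well as a function of its level *)

(** Intersecting with [[- r, r]] keeps the length finite and monotone for all
    levels [q], including those at which the well is not confined. *)
Definition sublevel (R : realType) (P : R -> R) (r q : R) : set R :=
  [set t | P t < q] `&` [set` `[- r, r]].

Definition sublength (R : realType) (P : R -> R) (r q : R) : R :=
  fine (@lebesgue_measure R (sublevel P r q)).

Lemma sublevel_measurable (R : realType) (P : R -> R) (r q : R) :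
  continuous P -> measurable (sublevel P r q).
Proof.
move=> cP; apply: measurableI; last exact: measurable_itv.
apply: open_measurable; apply: (@open_comp _ _ P [set x | x < q]).
  by move=> t _; exact: cP.
exact: open_lt.
Qed.

Lemma fin_num_in_segment (R : realType) (r : R) (A : set R) :
  measurable A -> A `<=` [set` `[- r, r]] -> @lebesgue_measure R A \is a fin_num.
Proof.
move=> mA AD; rewrite ge0_fin_numE; last exact: measure_ge0.
apply: (@le_lt_trans _ _ (@lebesgue_measure R [set` `[- r, r]])).
  by apply: le_measure => //; apply: mem_set => //; exact: measurable_itv.
by rewrite lebesgue_measure_itv/=; case: ifP => _; rewrite ?ltry// -EFinB ltry.
Qed.

Lemma sublevel_fin_num (R : realType) (P : R -> R) (r q : R) :
  continuous P -> @lebesgue_measure R (sublevel P r q) \is a fin_num.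
Proof.
move=> cP; apply: (@fin_num_in_segment R r); first exact: sublevel_measurable.
by move=> t [].
Qed.

Lemma sublength_ge0 (R : realType) (P : R -> R) (r q : R) :
  0 <= sublength P r q.
Proof. by apply: fine_ge0; exact: measure_ge0. Qed.

Lemma sublengthD (R : realType) (P : R -> R) (r x y : R) :
  continuous P -> x <= y ->
  sublength P r y =
  sublength P r x + fine (@lebesgue_measure R (sublevel P r y `\` sublevel P r x)).
Proof.
move=> cP xy; rewrite /sublength.
have xsy : sublevel P r x `<=` sublevel P r y.
  by move=> t [/= Pt tD]; split => //=; exact: lt_le_trans xy.
have mx := sublevel_measurable r x cP; have my := sublevel_measurable r y cP.
have mD := measurableD my mx.
rewrite -{1}(setDUK xsy) measureU//; last by rewrite setDIK.
rewrite fineD//; first exact: sublevel_fin_num.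
by apply: (@fin_num_in_segment R r) => // t [] [].
Qed.

Lemma sublength_nd (R : realType) (P : R -> R) (r x y : R) :
  continuous P -> x <= y -> sublength P r x <= sublength P r y.
Proof.
move=> cP xy; rewrite (sublengthD r cP xy) lerDl.
by apply: fine_ge0; exact: measure_ge0.
Qed.

(** Continuity of [sublength] at [q]: the sets {q - h <= P < q + h} decrease to
    the level set of [q], which is negligible because it is finite. *)
Lemma sublength_continuous (R : realType) (P : R -> R) (r q e : R) :
  continuous P -> finite_set [set t | P t = q] -> 0 < e ->
  exists2 dl, 0 < dl & sublength P r (q + dl) - sublength P r (q - dl) < e.
Proof.
move=> cP finq e0.
pose h k : R := k.+1%:R^-1.
have h0 k : 0 < h k by rewrite invr_gt0.
pose A k := sublevel P r (q + h k) `\` sublevel P r (q - h k).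
have mA k : measurable (A k) by apply: measurableD; exact: sublevel_measurable.
have capA : \bigcap_k A k = [set t | P t = q] `&` [set` `[- r, r]].
  apply/seteqP; split => t /=.
    move=> At; have [[_ tD] _] := At 0%N I; split=> //.
    apply/le_anti/andP; split; apply/ler_addgt0Pr => d d0.
      have [N _ /(_ N (leqnn _))/= Nd] := near_infty_natSinv_lt (PosNum d0).
      have [[/= Pt _] _] := At N I.
      by apply: ltW; apply: lt_trans Pt _; rewrite ltrD2l.
    have [N _ /(_ N (leqnn _))/= Nd] := near_infty_natSinv_lt (PosNum d0).
    have [_] := At N I => /not_andP[/negP|//]; rewrite -leNgt /= => Pt.
    by rewrite -lerBlDr; apply: le_trans Pt; rewrite lerD2l lerN2; exact: ltW.
  move=> [Ptq tD] k _; split; first by split => //=; rewrite Ptq ltrDl.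
  by move=> [/= + _]; rewrite Ptq; apply/negP; rewrite -leNgt lerBlDr lerDl ltW.
have finC : finite_set ([set t | P t = q] `&` [set` `[- r, r]]).
  by apply: sub_finite_set finq => t [].
have niA : nonincreasing_seq A.
  move=> i j ij; apply/subsetPset => t [[/= Pt tD] nt].
  have hij : h j <= h i by rewrite lef_pV2 ?posrE// ler_nat ltnS.
  split; first by split => //=; apply: lt_le_trans Pt _; rewrite lerD2l.
  move=> [/= Pt' _]; apply: nt; split => //=; apply: lt_le_trans Pt' _.
  by rewrite lerD2l lerN2.
have finA k : @lebesgue_measure R (A k) \is a fin_num.
  by apply: (@fin_num_in_segment R r) => // t [] [].
have : @lebesgue_measure R \o A @ \oo --> @lebesgue_measure R (\bigcap_k A k).
  apply: nonincreasing_cvg_mu => //.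
    by have := finA 0%N; rewrite ge0_fin_numE//; exact: measure_ge0.
  by apply: bigcap_measurable => [|k _]; [exists 0%N|exact: mA].
rewrite capA countable_lebesgue_measure0; last exact: finite_set_countable.
move/fine_cvg/cvgrPdist_lt => /(_ _ e0)[N _ /(_ N (leqnn _))/=].
rewrite sub0r normrN ger0_norm; last by apply: fine_ge0; exact: measure_ge0.
move=> AN; exists (h N) => //.
rewrite (@sublengthD R P r (q - h N) (q + h N))//.
  by rewrite [X in X < _]addrC addKr.
by have := h0 N; lra.
Qed.

(** Since P has a value below [x] and is at least [y] at [r], it crosses the band
    [[x, y]]; the crossing takes at least the time (y - x) / eps. *)
Lemma sublength_steep (R : realType) (P : R -> R) (r eps x y : R) :
  continuous P -> 0 < eps ->
  (forall s t, s \in `[- r, r] -> t \in `[- r, r] ->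
     `|P t - P s| <= eps * `|t - s|) ->
  y <= P r -> x < y -> 0 < sublength P r x ->
  y - x <= eps * (sublength P r y - sublength P r x).
Proof.
move=> cP e0 lip yr xy mx.
have [t0 [Pt0 t0D]] : sublevel P r x !=set0.
  apply/set0P/eqP => sx0; move: mx.
  by rewrite /sublength sx0 measure0 ltxx.
move: (t0D); rewrite /= in_itv/= => /andP[rt0 t0r].
pose E := [set t | t0 <= t <= r /\ y <= P t].
have Er : E r by rewrite /E /= t0r lexx.
have lbE : lbound E t0 by move=> t [/andP[]].
have hlE : has_lbound E by exists t0.
have hiE : has_inf E by split; [exists r|].
(* The first time after t0 at which P reaches y. *)
pose s' := inf E.
have t0s' : t0 <= s' by apply: lb_le_inf => //; exists r.
have s'r : s' <= r by apply: ge_inf.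
have s'D : s' \in `[- r, r] by rewrite in_itv/= s'r (le_trans rt0).
have Ps' : y <= P s'.
  apply/ler_addgt0Pr => d d0.
  have de0 : 0 < d / eps by rewrite divr_gt0.
  have [t [/andP[t0t tr] yPt] ts'] := inf_adherent de0 hiE.
  have s't : s' <= t by apply: ge_inf => //; split => //; apply/andP.
  have tD : t \in `[- r, r] by rewrite in_itv/= tr (le_trans rt0).
  have := lip _ _ s'D tD; rewrite (ger0_norm (_ : 0 <= t - s')) ?subr_ge0// => L.
  have : eps * (t - s') <= d by rewrite mulrC -ler_pdivlMr// lerBlDl ltW.
  have := ler_norm (P t - P s'); lra.
have below t : t0 <= t -> t < s' -> P t < y.
  move=> t0t ts'; rewrite ltNge; apply/negP => yPt.
  have : s' <= t by apply: ge_inf => //; split => //; rewrite t0t (le_trans (ltW ts')).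
  by rewrite leNgt ts'.
(* P cannot descend from y to below x within time (y - x) / eps before s'; in
   particular t0, where P < x, comes before s. *)
pose s := s' - (y - x) / eps.
have t0s : t0 <= s.
  have := lip _ _ t0D s'D; rewrite (ger0_norm (_ : 0 <= s' - t0)) ?subr_ge0// => L.
  rewrite /s lerBrDr -lerBrDl ler_pdivrMr// mulrC.
  by have := ler_norm (P s' - P t0); move: Pt0 => /=; lra.
have ss' : s < s' by rewrite /s ltrBlDr ltrDl divr_gt0// subr_gt0.
have sub : [set` `[s, s'[] `<=` sublevel P r y `\` sublevel P r x.
  move=> t /=; rewrite in_itv/= => /andP[st ts'].
  have t0t := le_trans t0s st.
  have tD : t \in `[- r, r].
    by rewrite in_itv/= (le_trans rt0 t0t) (le_trans (ltW ts')).
  split; first by split => //=; exact: below.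
  move=> [/= + _]; apply/negP; rewrite -leNgt.
  have := lip _ _ tD s'D.
  rewrite (ger0_norm (_ : 0 <= s' - t)) ?subr_ge0 ?(ltW ts')// => L.
  have : eps * (s' - t) <= y - x.
    by rewrite mulrC -ler_pdivlMr//; move: st; rewrite /s; lra.
  by have := ler_norm (P s' - P t); lra.
rewrite (sublengthD r cP (ltW xy)) [X in _ * (X - _)]addrC addrK.
rewrite -ler_pdivrMl// mulrC.
have mD : measurable (sublevel P r y `\` sublevel P r x).
  by apply: measurableD; exact: sublevel_measurable.
rewrite -lee_fin fineK; last first.
  by apply: (@fin_num_in_segment R r) => // t [] [].
apply: (@le_trans _ _ (@lebesgue_measure R [set` `[s, s'[])).
  rewrite lebesgue_measure_itv/= lte_fin ss' -EFinB lee_fin /s; lra.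
by apply: le_measure => //; apply: mem_set => //; exact: measurable_itv.
Qed.

Definition well_area (R : realType) (P : R -> R) (q : R) : R :=
  \int[@lebesgue_measure R]_t Num.max (q - P t) 0.

Lemma well_integrable (R : realType) (P : R -> R) (r q : R) :
  continuous P ->
  (@lebesgue_measure R).-integrable [set` `[- r, r]]
    (EFin \o (fun t => Num.max (q - P t) 0)).
Proof.
move=> cP; apply: continuous_compact_integrable; first exact: segment_compact.
apply: continuous_subspaceT => t.
apply: (@continuous_max _ _ (fun t => q - P t) (fun=> 0)).
  by apply: continuousB; [exact: cst_continuous|exact: cP].
exact: cst_continuous.
Qed.

Lemma sublevel_integrable (R : realType) (P : R -> R) (r q : R) :
  continuous P ->
  (@lebesgue_measure R).-integrable [set` `[- r, r]]
    (EFin \o (\1_(sublevel P r q) : R -> R)).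
Proof.
move=> cP; have mS := sublevel_measurable r q cP.
apply: measurable_bounded_integrable.
- exact: measurable_itv.
- rewrite -ge0_fin_numE; last exact: measure_ge0.
  by apply: (@fin_num_in_segment R r) => //; exact: measurable_itv.
- exact: measurable_indic.
- exists 1; split; first exact: real1.
  move=> M M1 t _; rewrite /= ger0_norm ?indicE; last by rewrite ler0n.
  by apply: ltW; apply: le_lt_trans M1; case: (t \in _).
Qed.

Lemma Rintegral_sublevel (R : realType) (P : R -> R) (r q h : R) :
  continuous P ->
  \int[@lebesgue_measure R]_(t in [set` `[- r, r]]) (h * \1_(sublevel P r q) t)
  = h * sublength P r q.
Proof.
move=> cP; rewrite RintegralZl//; last exact: sublevel_integrable.
congr (_ * _); rewrite /Rintegral /= integral_indic//; last exact: sublevel_measurable.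
by rewrite /sublength /sublevel -setIA setIid.
Qed.

Lemma well_areaE (R : realType) (P : R -> R) (r q : R) :
  (forall t, t \notin `[- r, r] -> q <= P t) ->
  well_area P q =
  \int[@lebesgue_measure R]_(t in [set` `[- r, r]]) Num.max (q - P t) 0.
Proof.
move=> coer; rewrite [RHS]Rintegral_mkcond; apply: eq_Rintegral => t _.
rewrite patchE; case: ifPn => //; rewrite notin_setE /= => /negP tD.
by apply/max_idPr; rewrite subr_le0 coer.
Qed.

(** Between the levels x and y, the integrand grows by exactly y - x on the lower
    sublevel set, by at most y - x on the upper one, and not at all outside. *)
Lemma well_area_increment (R : realType) (P : R -> R) (r x y : R) :
  continuous P -> (forall t, t \notin `[- r, r] -> y <= P t) -> x <= y ->
  (y - x) * sublength P r x <= well_area P y - well_area P x <=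
  (y - x) * sublength P r y.
Proof.
move=> cP coer xy.
have coerx t : t \notin `[- r, r] -> x <= P t by move=> /coer; exact: le_trans.
rewrite (well_areaE coer) (well_areaE coerx) -RintegralB//; try exact: well_integrable.
have iB : (@lebesgue_measure R).-integrable [set` `[- r, r]]
    (EFin \o (fun t => Num.max (y - P t) 0 - Num.max (x - P t) 0)).
  change ((@lebesgue_measure R).-integrable [set` `[- r, r]]
    (fun t => (Num.max (y - P t) 0)%:E - (Num.max (x - P t) 0)%:E)%E).
  by apply: integrableB; [exact: measurable_itv|exact: well_integrable..].
have iS q : (@lebesgue_measure R).-integrable [set` `[- r, r]]
    (EFin \o (fun t => (y - x) * \1_(sublevel P r q) t)).
  change ((@lebesgue_measure R).-integrable [set` `[- r, r]]
    (fun t => (y - x)%:E * (\1_(sublevel P r q) t : R)%:E)%E).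
  by apply: integrableZl; [exact: measurable_itv|exact: sublevel_integrable].
rewrite -!Rintegral_sublevel//; apply/andP; split; apply: le_Rintegral => // t tD;
  rewrite indicE; have [tS|tS] := boolP (t \in _); rewrite ?mulr1 ?mulr0.
- move: tS => /set_mem[/= Pt _].
  by rewrite !max_l ?subr_ge0//; lra.
- by rewrite subr_ge0 ge_max !le_max lexx orbT andbT lerD2r xy.
- move: tS => /set_mem[/= Pt _].
  have yPt : 0 <= y - P t by rewrite subr_ge0 ltW.
  rewrite (max_l yPt).
  have : x - P t <= Num.max (x - P t) 0 by rewrite le_max lexx.
  by move: (Num.max _ _) => M; lra.
- move: tS; rewrite notin_setE => /not_andP[/negP|//]; rewrite -leNgt => Pt.
  rewrite !max_r ?subr_le0 ?subrr//.
  exact: le_trans Pt.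
Qed.

(** [well_area_increment] encloses the difference quotients between values of
    [sublength] near [q], which is continuous at [q]. *)
Lemma is_derive_well_area (R : realType) (P : R -> R) (r top q : R) :
  continuous P -> (forall t, t \notin `[- r, r] -> top <= P t) ->
  finite_set [set t | P t = q] -> q < top ->
  is_derive q 1 (well_area P) (sublength P r q).
Proof.
move=> cP coer finq qtop.
suff cv : (fun h => h^-1 *: (well_area P (h *: 1 + q) - well_area P q)) @ 0^'
    --> sublength P r q.
  by apply: DeriveDef; [apply/cvg_ex; exists (sublength P r q)|exact/cvg_lim].
apply/cvgrPdist_le => e e0.
have [dl dl0 dlP] := sublength_continuous r cP finq e0.
have coer' y : y <= top -> forall t, t \notin `[- r, r] -> y <= P t.
  by move=> ytop t /coer; exact: le_trans.
near=> h.
have h0 : h != 0 by near: h; exact: nbhs_dnbhs_neq.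
have hdl : `|h| < dl by near: h; exact: dnbhs0_lt.
have htop : `|h| < top - q by near: h; apply: dnbhs0_lt; rewrite subr_gt0.
have mono x y : x <= y -> sublength P r x <= sublength P r y.
  exact: sublength_nd.
have h1 : h%:A = h :> R by rewrite /GRing.scale/= mulr1.
rewrite h1 /GRing.scale/=.
move: hdl htop; rewrite !ltr_norml => /andP[h_gt h_lt] /andP[_ h_top].
have m1 := mono (q - dl) q ltac:(lra); have m2 := mono q (q + dl) ltac:(lra).
move: h0; rewrite neq_lt => /orP[h0|h0].
  have := @well_area_increment R P r (h + q) q cP (coer' q (ltW qtop)) ltac:(lra).
  have m3 := mono (q - dl) (h + q) ltac:(lra).
  rewrite (_ : q - (h + q) = - h); last by ring.
  set a1 := well_area _ _; set a2 := well_area _ _ => /andP[l1 l2].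
  have -> : h^-1 * (a2 - a1) = (- h)^-1 * (a1 - a2) by field; lra.
  have nh : 0 < - h by lra.
  rewrite ler_norml; apply/andP; split.
    rewrite lerNl opprB lerBlDr mulrC ler_pdivrMr// mulrC.
    by apply: le_trans l2 _; apply: ler_wpM2l; [exact: ltW|lra].
  rewrite lerBlDr -lerBlDl mulrC ler_pdivlMr// mulrC.
  by apply: le_trans l1; apply: ler_wpM2l; [exact: ltW|lra].
have := @well_area_increment R P r q (h + q) cP (coer' (h + q) ltac:(lra)) ltac:(lra).
have m3 := mono (h + q) (q + dl) ltac:(lra).
rewrite (_ : h + q - q = h); last by ring.
set a1 := well_area _ _; set a2 := well_area _ _ => /andP[l1 l2].
rewrite ler_norml; apply/andP; split.
  rewrite lerNl opprB lerBlDr mulrC ler_pdivrMr// mulrC.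
  by apply: le_trans l2 _; apply: ler_wpM2l; [exact: ltW|lra].
rewrite lerBlDr -lerBlDl mulrC ler_pdivlMr// mulrC.
by apply: le_trans l1; apply: ler_wpM2l; [exact: ltW|lra].
Unshelve. all: by end_near. Qed.

(** * The polynomial cap *)

Definition potential (R : realType) (nu : nat) (a : R) (u : 'rV[R]_(nu - 2)) :
    {poly R} :=
  a *: 'X^nu + \sum_(j < nu - 2) u 0 j *: 'X^(j.+1).

Lemma potentialE (R : realType) (nu : nat) (a : R) (u : 'rV[R]_(nu - 2)) (t : R) :
  (potential a u).[t] = a * t ^+ nu + \sum_(j < nu - 2) u 0 j * t ^+ j.+1.
Proof.
rewrite /potential !hornerE horner_sum; congr (_ + _).
by apply: eq_bigr => j _; rewrite !hornerE.
Qed.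

Lemma capE (R : realType) (nu : nat) (a q : R) (u : 'rV[R]_(nu - 2)) :
  cap nu a q u = well_area (horner (potential a u)) q.
Proof.
apply: eq_Rintegral => t _; congr (Num.max _ _).
by rewrite potentialE opprD addrA.
Qed.

Lemma potential_level_finite (R : realType) (nu : nat) (a q : R)
    (u : 'rV[R]_(nu - 2)) :
  (2 <= nu)%N -> a != 0 -> finite_set [set t | (potential a u).[t] = q].
Proof.
move=> nu2 a0; set p := potential a u - q%:P.
have p0 : p != 0.
  apply/eqP => /(congr1 (fun s : {poly R} => s`_nu)); rewrite coef0 /p /potential.
  rewrite !coefB coefD coefZ coefXn eqxx mulr1 coefC coef_sum.
  rewrite (_ : (nu == 0%N) = false); last lia.
  rewrite big1 ?addr0 ?subr0; first by move/eqP; rewrite (negPf a0).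
  move=> j _; rewrite coefZ coefXn (_ : (nu == j.+1) = false) ?mulr0//.
  by have := ltn_ord j; lia.
apply: contrapT => /(@infinite_set_fset _ _ (size p))[B BA].
rewrite leqNgt => /negP; apply.
apply: (max_poly_roots p0); last exact: fset_uniq.
apply/allP => t tB; rewrite rootE /p hornerD hornerN hornerC.
by rewrite (BA t tB : (potential a u).[t] = q) subrr.
Qed.

Lemma is_derive_cap (R : realType) (nu : nat) (a r top q : R) (u : 'rV[R]_(nu - 2)) :
  (2 <= nu)%N -> 0 < a ->
  (forall t, r <= `|t| -> top <= (potential a u).[t]) -> q < top ->
  is_derive q 1 (cap nu a ^~ u) (sublength (horner (potential a u)) r q).
Proof.
move=> nu2 a0 coer qtop.
have -> : cap nu a ^~ u = well_area (horner (potential a u)).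
  by apply/funext => t; rewrite capE.
apply: (@is_derive_well_area R _ r top q) => //.
- exact: continuous_horner.
- by move=> t; rewrite in_itv/= -ler_norml -ltNge => /ltW /coer.
- exact: potential_level_finite nu2 (lt0r_neq0 a0).
Qed.

Lemma exprS_lipschitz (R : realType) (k : nat) (r s t : R) :
  `|s| <= r -> `|t| <= r ->
  `|t ^+ k.+1 - s ^+ k.+1| <= k.+1%:R * r ^+ k * `|t - s|.
Proof.
move=> sr tr; have r0 : 0 <= r := le_trans (normr_ge0 _) sr.
elim: k => [|k IH]; first by rewrite !expr1 expr0 !mul1r.
have -> : t ^+ k.+2 - s ^+ k.+2 = t * (t ^+ k.+1 - s ^+ k.+1) + (t - s) * s ^+ k.+1.
  by rewrite [t ^+ k.+2]exprS [s ^+ k.+2]exprS; ring.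
apply: le_trans (ler_normD _ _) _; rewrite !normrM normrX.
have -> : k.+2%:R * r ^+ k.+1 * `|t - s| =
    r * (k.+1%:R * r ^+ k * `|t - s|) + `|t - s| * r ^+ k.+1.
  by rewrite (natrD _ 1 k.+1) exprS; ring.
apply: lerD; first by apply: ler_pM.
by apply: ler_wpM2l => //; apply: lerXn2r.
Qed.

Lemma potential_lipschitz (R : realType) (nu : nat) (a r dl s t : R)
    (u : 'rV[R]_(nu - 2)) :
  (2 <= nu)%N -> 0 <= a -> r <= 1 -> 0 <= dl -> (forall j, `|u 0 j| <= dl) ->
  `|s| <= r -> `|t| <= r ->
  `|(potential a u).[t] - (potential a u).[s]| <=
  (a * nu%:R * r + nu%:R * nu%:R * dl) * `|t - s|.
Proof.
move=> nu2 a0 r1 dl0 udl sr tr; have r0 : 0 <= r := le_trans (normr_ge0 _) sr.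
rewrite !potentialE opprD addrACA -mulrBr -sumrB.
apply: le_trans (ler_normD _ _) _; rewrite mulrDl; apply: lerD.
  rewrite normrM ger0_norm// -!mulrA; apply: ler_wpM2l => //.
  case: nu nu2 {u udl} => [//|[//|nu]] _.
  apply: le_trans (exprS_lipschitz _ sr tr) _; rewrite -mulrA.
  apply: ler_wpM2l => //; apply: ler_wpM2r => //.
  by rewrite exprS ler_piMr// exprn_ile1.
apply: le_trans (ler_norm_sum _ _ _) _.
apply: (@le_trans _ _ (\sum_(j < nu - 2) nu%:R * dl * `|t - s|)).
  apply: ler_sum => j _; rewrite -mulrBr normrM.
  apply: (@le_trans _ _ (dl * (j.+1%:R * r ^+ j * `|t - s|))).
    by apply: ler_pM => //; exact: exprS_lipschitz.
  rewrite [nu%:R * dl]mulrC -[leRHS]mulrA; apply: ler_wpM2l => //; apply: ler_wpM2r => //.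
  apply: (@le_trans _ _ j.+1%:R); first by rewrite ler_piMr// exprn_ile1.
  by rewrite ler_nat; have := ltn_ord j; lia.
rewrite sumr_const card_ord -[_ *+ (nu - 2)]mulr_natl -!mulrA.
apply: ler_wpM2r; last by rewrite ler_nat; lia.
by rewrite !mulr_ge0.
Qed.

Lemma potential_coercive (R : realType) (nu : nat) (a r dl t : R)
    (u : 'rV[R]_(nu - 2)) :
  (2 <= nu)%N -> ~~ odd nu -> 0 < r -> r <= 1 -> 0 <= dl ->
  (forall j, `|u 0 j| <= dl) -> nu%:R * dl <= a / 2 * r ^+ nu ->
  r <= `|t| -> a / 2 * r ^+ nu <= (potential a u).[t].
Proof.
move=> nu2 nu_even r0 r1 dl0 udl dlr rt; rewrite potentialE.
set w := (`|t| / r) ^+ nu.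
have w1 : 1 <= `|t| / r by rewrite ler_pdivlMr// mul1r.
have w1' : 1 <= w by rewrite exprn_ege1.
have tw : t ^+ nu = r ^+ nu * w.
  rewrite -exprMn mulrC divfK ?gt_eqF//.
  by rewrite -normrX ger0_norm// exprn_even_ge0.
have : `|\sum_(j < nu - 2) u 0 j * t ^+ j.+1| <= nu%:R * dl * w.
  apply: le_trans (ler_norm_sum _ _ _) _.
  apply: (@le_trans _ _ (\sum_(j < nu - 2) dl * w)).
    apply: ler_sum => j _; rewrite normrM; apply: ler_pM => //.
    rewrite normrX -[X in X ^+ _](divfK (lt0r_neq0 r0)) exprMn.
    apply: (@le_trans _ _ ((`|t| / r) ^+ j.+1)).
      by rewrite ler_piMr ?exprn_ile1 ?exprn_ge0 ?divr_ge0// ltW.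
    by apply: ler_weXn2l => //; have := ltn_ord j; lia.
  rewrite sumr_const card_ord -[_ *+ (nu - 2)]mulr_natl mulrA.
  apply: ler_wpM2r; first lra.
  by apply: ler_wpM2r => //; rewrite ler_nat; lia.
rewrite ler_norml => /andP[+ _]; rewrite tw.
have : nu%:R * dl * w <= a / 2 * r ^+ nu * w by apply: ler_wpM2r => //; lra.
have : 0 <= a / 2 * r ^+ nu by apply: le_trans dlr; rewrite mulr_ge0.
set A := r ^+ nu; set sm := \sum_(_ < _) _ => A0 H1 H2.
have : a / 2 * A <= a / 2 * A * w by rewrite ler_peMr.
by nra.
Qed.

(** The radius [r] is chosen first, to make the slope of a t^nu small; then the
    bound [dl] on the coefficients, so that the terms of lower degree neither add
    much slope nor undo the confinement provided by a t^nu at |t| >= r. *)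
Lemma flat_confining_wells (R : realType) (nu : nat) (a eps : R) :
  (2 <= nu)%N -> ~~ odd nu -> 0 < a -> 0 < eps ->
  exists r top dl : R, [/\ 0 < r, 0 < top, 0 < dl &
    forall u : 'rV[R]_(nu - 2), (forall j, `|u 0 j| <= dl) ->
      (forall s t, s \in `[- r, r] -> t \in `[- r, r] ->
        `|(potential a u).[t] - (potential a u).[s]| <= eps * `|t - s|) /\
      (forall t, r <= `|t| -> top <= (potential a u).[t])].
Proof.
move=> nu2 nu_even a0 eps0.
have nu0 : 0 < nu%:R :> R by rewrite ltr0n; lia.
pose r := Num.min 1 (eps / 2 / (a * nu%:R)).
have r0 : 0 < r by rewrite lt_min ltr01 !divr_gt0// mulr_gt0.
have r1 : r <= 1 by rewrite ge_min lexx.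
have rE : a * nu%:R * r <= eps / 2.
  by rewrite mulrC -ler_pdivlMr ?mulr_gt0// ge_min lexx orbT.
pose top := a / 2 * r ^+ nu.
have top0 : 0 < top by rewrite mulr_gt0 ?divr_gt0// exprn_gt0.
pose dl := Num.min (eps / 2 / (nu%:R * nu%:R)) (top / nu%:R).
have dl0 : 0 < dl by rewrite lt_min !divr_gt0// mulr_gt0.
have dlE : nu%:R * nu%:R * dl <= eps / 2.
  by rewrite mulrC -ler_pdivlMr ?mulr_gt0// ge_min lexx.
have dlT : nu%:R * dl <= a / 2 * r ^+ nu.
  by rewrite mulrC -ler_pdivlMr// ge_min lexx orbT.
exists r, top, dl; split => // u udl; split.
  move=> s t; rewrite !in_itv/= -!ler_norml => sr tr.
  apply: le_trans (potential_lipschitz nu2 (ltW a0) r1 (ltW dl0) udl sr tr) _.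
  by apply: ler_wpM2r => //; lra.
by move=> t rt; apply: (potential_coercive nu2 nu_even r0 r1 (ltW dl0) udl).
Qed.

Lemma cap0_le0 (R : realType) (nu : nat) (a q : R) :
  ~~ odd nu -> 0 <= a -> q <= 0 -> cap nu a q 0 = 0.
Proof.
move=> nu_even a0 q0; rewrite capE /well_area.
rewrite (@eq_Rintegral _ _ _ _ _ (fun=> 0)); first by rewrite Rintegral_cst ?mul0r.
move=> t _; apply/max_idPr; rewrite subr_le0 potentialE big1; last first.
  by move=> j _; rewrite mxE mul0r.
by rewrite addr0 (le_trans q0)// mulr_ge0// exprn_even_ge0.
Qed.

(** At the level q / 2 the sublevel set contains [[0, q / (2 eps)[] for every
    slope eps, and the area grows by at least q / 2 times this length between
    the levels q / 2 and q. *)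
Lemma cap0_superquadratic (R : realType) (nu : nat) (a L : R) :
  (2 <= nu)%N -> ~~ odd nu -> 0 < a -> 0 < L ->
  exists2 q0, 0 < q0 & forall q, 0 < q -> q <= q0 -> L * q ^+ 2 <= cap nu a q 0.
Proof.
move=> nu2 nu_even a0 L0.
(* Then (q / 2) * (q / (2 eps)) = L q^2. *)
pose eps := (4 * L)^-1.
have eps0 : 0 < eps by rewrite invr_gt0 mulr_gt0.
have [r [top [dl [r0 top0 dl0 /(_ 0)[|lip coer]]]]] :=
  flat_confining_wells nu2 nu_even a0 eps0.
  by move=> j; rewrite mxE normr0 ltW.
set P := horner (potential a 0) in lip coer *.
have cP : continuous P by exact: continuous_horner.
have P0 : P 0 = 0.
  rewrite /P potentialE expr0n (_ : (nu == 0%N) = false) ?mulr0 ?add0r; last lia.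
  by rewrite big1// => j _; rewrite mxE mul0r.
exists (Num.min top (2 * eps * r)); first by rewrite lt_min top0 !mulr_gt0.
move=> q q0; rewrite le_min => /andP[qtop qr].
have coer' y : y <= q -> forall t, t \notin `[- r, r] -> y <= P t.
  move=> yq t; rewrite in_itv/= -ler_norml -ltNge => /ltW /coer.
  by apply: le_trans; exact: le_trans yq qtop.
rewrite capE -/P.
have /andP[l1 _] :=
  @well_area_increment R P r (q / 2) q cP (coer' q (lexx q)) ltac:(lra).
have /andP[l2 _] :=
  @well_area_increment R P r 0 (q / 2) cP (coer' (q / 2) ltac:(lra)) ltac:(lra).
have area0 : well_area P 0 = 0 by rewrite -capE; apply: cap0_le0 => //; exact: ltW.
have w0 : 0 < q / (2 * eps) by rewrite divr_gt0// mulr_gt0.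
have wr : q / (2 * eps) <= r by rewrite ler_pdivrMr ?mulr_gt0// mulrC.
have m2 : q / (2 * eps) <= sublength P r (q / 2).
  rewrite -lee_fin fineK; last exact: sublevel_fin_num.
  apply: (@le_trans _ _ (@lebesgue_measure R [set` `[0, q / (2 * eps)[])).
    by rewrite lebesgue_measure_itv/= lte_fin w0 sube0.
  apply: le_measure => //; try apply: mem_set; try exact: measurable_itv.
    exact: sublevel_measurable.
  move=> t /=; rewrite in_itv/= => /andP[t0 tw].
  have tD : t \in `[- r, r] by rewrite in_itv/=; apply/andP; split; lra.
  split => //=.
  have := lip 0 t ltac:(rewrite in_itv/=; lra) tD.
  rewrite P0 !subr0 (ger0_norm t0) => Pt.
  apply: le_lt_trans (ler_norm _) _; apply: le_lt_trans Pt _.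
  by rewrite -ltr_pdivlMl// (_ : eps^-1 * (q / 2) = q / (2 * eps))//; field; lra.
have m0 : 0 <= (q / 2 - 0) * sublength P r 0.
  by rewrite mulr_ge0 ?sublength_ge0//; lra.
have : L * q ^+ 2 <= (q - q / 2) * sublength P r (q / 2).
  apply: (@le_trans _ _ ((q - q / 2) * (q / (2 * eps)))); last first.
    by apply: ler_wpM2l => //; lra.
  by rewrite /eps le_eqVlt; apply/orP; left; apply/eqP; field; lra.
lra.
Qed.

(** * Derivatives in the first variable of a function of class C^k *)

Definition dqn (R : realType) (L : normedModType R) (j : nat)
    (S : R * L -> R) : R * L -> R :=
  iter j (fun f : R * L -> R => 'D_(1, 0) f) S.

Lemma Ck_continuous (R : realType) (V W : normedModType R) (k : nat) (U : set V)
    (f : V -> W) : Ck k U f -> {in U, continuous f}.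
Proof.
by case: k => [//|k] [df _] x /df /differentiable_continuous.
Qed.

Lemma Ck_dqn (R : realType) (L : normedModType R) (k j : nat)
    (U : set (R * L)) (S : R * L -> R) :
  Ck k U S -> (j <= k)%N -> Ck (k - j) U (dqn j S).
Proof.
move=> CS; elim: j => [|j IH] jk; first by rewrite subn0.
have := IH (ltnW jk); rewrite (_ : (k - j = (k - j.+1).+1)%N); last lia.
by move=> [_]; apply.
Qed.

Lemma is_derive_line (R : realType) (V W : normedModType R) (f : V -> W)
    (x v : V) (t : R) :
  differentiable f (x + t *: v) ->
  is_derive t 1 (fun s : R => f (x + s *: v)) ('D_v f (x + t *: v)).
Proof.
move=> df; have fv := @diff_derivable _ _ _ _ _ v df.
have E : (fun h : R => h^-1 *: (f (x + (h *: 1 + t) *: v) - f (x + t *: v))) =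
    (fun h : R => h^-1 *: (f (h *: v + (x + t *: v)) - f (x + t *: v))).
  apply/funext => h; congr (_ *: (f _ - _)).
  by rewrite [h%:A]mulr1 scalerDl addrCA addrA [X in X + _]addrC.
have := fv; rewrite /derivable.
move=> fv'; apply: DeriveDef.
  by rewrite /derivable E.
by rewrite /derive E.
Qed.

Lemma is_derive_slice (R : realType) (L : normedModType R) (f : R * L -> R)
    (q : R) (l : L) :
  differentiable f (q, l) ->
  is_derive q 1 (fun s : R => f (s, l)) ('D_(1, 0) f (q, l)).
Proof.
have qlE s : (0, l) + s *: (1, 0) = (s, l) :> R * L.
  by congr pair; rewrite /= ?add0r ?[_%:A]mulr1// scaler0 addr0.
move=> df; have := @is_derive_line R _ _ f (0, l) (1, 0) q.
rewrite qlE => /(_ df).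
by under eq_fun do rewrite qlE.
Qed.

(** Iterated one-variable derivatives along the first coordinate only agree with
    iterated directional derivatives where the latter exist in a whole
    neighbourhood, hence the induction over all points of the open set [U]. *)
Lemma derive1n_slice (R : realType) (L : normedModType R) (k j : nat)
    (U : set (R * L)) (S : R * L -> R) (q : R) (l : L) :
  open U -> Ck k U S -> (j <= k)%N -> U (q, l) ->
  derive1n j (fun s : R => S (s, l)) q = dqn j S (q, l).
Proof.
move=> oU CS; elim: j q => [//|j IH] q jk Uql.
rewrite derive1nS derive1E.
have nU : nbhs (q, l) U by apply: open_nbhs_nbhs.
have near_eq : \forall s \near q,
    derive1n j (fun s : R => S (s, l)) s = dqn j S (s, l).
  move: nU => [[A B] /= [nA nB] AB]; near=> s; apply: IH; first exact: ltnW.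
  apply: AB; split => /=; last exact: nbhs_singleton.
  by near: s.
rewrite (near_eq_derive _ near_eq).
have := Ck_dqn CS (ltnW jk); rewrite (_ : (k - j = (k - j.+1).+1)%N); last lia.
move=> [df _]; have := @is_derive_slice R L (dqn j S) q l.
move=> /(_ (df _ (mem_set Uql))) fd.
by rewrite derive_val.
Unshelve. all: by end_near. Qed.

Lemma is_derive_dqn (R : realType) (L : normedModType R) (k j : nat)
    (U : set (R * L)) (S : R * L -> R) (q : R) (l : L) :
  Ck k U S -> (j < k)%N -> U (q, l) ->
  is_derive q 1 (fun s : R => dqn j S (s, l)) (dqn j.+1 S (q, l)).
Proof.
move=> CS jk Uql; apply: is_derive_slice.
have := Ck_dqn CS (ltnW jk); rewrite (_ : (k - j = (k - j.+1).+1)%N); last lia.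
by move=> [df _]; apply: df; exact: mem_set.
Qed.

Lemma nbhs0_box (R : realType) (L : normedModType R) (U : set (R * L)) :
  nbhs (0 : R * L) U ->
  exists2 rho : R, 0 < rho & exists2 V : set L, nbhs 0 V &
    forall q l, `|q| < rho -> V l -> U (q, l).
Proof.
move=> [[A B] /= [nA nB] AB].
move: nA => /nbhs_ballP[rho rho0 rA]; exists rho => //; exists B => // q l qr Bl.
by apply: AB; split => //=; apply: rA; rewrite -ball_normE /= sub0r normrN.
Qed.

(** One box on which all local hypotheses hold at once; [A] stands for any further
    property that holds near 0. *)
Lemma local_box (R : realType) (L : normedModType R) (n : nat)
    (S : R * L -> R) (d : L -> R) (A : R * L -> Prop) (c eta : R) :
  (2 <= n)%N -> Ck_near n.+1 0 S -> Ck_near 2 0 d -> d 0 != 0 ->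
  (\forall z \near (0 : R * L), A z) ->
  dqn n S 0 = n`!%:R * c -> 0 < eta ->
  exists rho (V : set L), [/\ 0 < rho, nbhs 0 V,
    forall l, V l -> `|d l - d 0| < `|d 0| / 2 &
    forall q l, q \in `]- rho, rho[ -> V l ->
      [/\ A (q, l), `|dqn n S (q, l) - n`!%:R * c| <= eta,
          `|dqn 2 S (q, l)| <= `|dqn 2 S 0| + 1 &
          forall j, (j < n.+1)%N -> is_derive q 1
            (fun s : R => dqn j S (s, l)) (dqn j.+1 S (q, l))]].
Proof.
move=> n2 [U [oU U0] CS] [Ud [oUd Ud0] [dd _]] d0 nA Sn eta0.
have nU : nbhs (0 : R * L) U by apply: open_nbhs_nbhs.
have cont j : (j <= n.+1)%N -> {for 0, continuous (dqn j S)}.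
  by move=> jn; apply: Ck_continuous (Ck_dqn CS jn) _ (mem_set U0).
have near_n : \forall z \near (0 : R * L), `|dqn n S z - n`!%:R * c| <= eta.
  have /cvgrPdist_le/(_ _ eta0) := cont n (leqnSn n).
  by rewrite Sn; apply: filterS => z; rewrite distrC.
have near_2 : \forall z \near (0 : R * L), `|dqn 2 S z| <= `|dqn 2 S 0| + 1.
  have /cvgrPdist_le/(_ _ ltr01) := cont 2%N (leqW n2).
  apply: filterS => z zb; rewrite -lerBlDl.
  by apply: le_trans (lerB_dist _ _) _; rewrite distrC.
have near_d : \forall l \near (0 : L), `|d l - d 0| < `|d 0| / 2.
  have e0 : 0 < `|d 0| / 2 by rewrite divr_gt0// normr_gt0.
  have cd : {for 0, continuous d}.
    by apply: differentiable_continuous; apply: dd; exact: mem_set.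
  have /cvgrPdist_lt/(_ _ e0) := cd.
  by apply: filterS => z; rewrite distrC.
have [rho rho0 [V nV box]] := nbhs0_box (filterI nU (filterI nA (filterI near_n near_2))).
exists rho, (V `&` [set l | `|d l - d 0| < `|d 0| / 2]); split => //.
- exact: filterI.
- by move=> l [].
move=> q l; rewrite in_itv/= -ltr_norml => qr [Vl _].
have [Uql [Aql [nql n2ql]]] := box q l qr Vl.
by split => // j jn; exact: is_derive_dqn CS jn Uql.
Qed.

Lemma sign_perturbation (R : realType) (c d0 d : R) :
  `|d - d0| < `|d0| / 2 -> d0 != 0 ->
  [/\ d != 0, `|d0| / 2 < `|d| & (0 < c * d) = (0 < c * d0)].
Proof.
move=> + d0n; have nd0 : 0 < `|d0| by rewrite normr_gt0.
move=> H; have dle : `|d0| / 2 < `|d|.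
  have := ler_normD (d0 - d) d; rewrite subrK distrC; lra.
split => //; first by rewrite -normr_gt0; lra.
move: H; rewrite ltr_norml => /andP[h1 h2].
have [d0p|d0m|d00] := ltrgtP 0 d0; last by move: d0n; rewrite -d00 eqxx.
  by rewrite (gtr0_norm d0p) in h1; rewrite !pmulr_lgt0//; lra.
by rewrite (ltr0_norm d0m) in h2; rewrite !nmulr_lgt0//; lra.
Qed.

(** * Local surjectivity of the central coefficient map *)

HB.instance Definition _ (R : realType) (n : nat) :=
  Complete.copy 'rV[R]_n (matrix R 1 n).

Lemma row_norm_le (R : realType) (n : nat) (s : R) (x : 'rV[R]_n) :
  0 <= s -> (forall i, `|x 0 i| <= s) -> `|x| <= s.
Proof.
move=> s0 xs; rewrite [leLHS]/Num.Def.normr/= mx_normrE.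
by apply/bigmax_leP; split => // -[i j] _ /=; rewrite (ord1 i).
Qed.

Lemma row_coord_le (R : realType) (n : nat) (x : 'rV[R]_n) i : `|x 0 i| <= `|x|.
Proof.
rewrite [leRHS]/Num.Def.normr/= mx_normrE.
by apply: (@le_bigmax _ _ _ _ (fun ij => `|x ij.1 ij.2|) (0, i)).
Qed.

Lemma mulmx_norm_le (R : realType) (n m : nat) (B : 'M[R]_(n, m)) (y : 'rV[R]_n) :
  `|y *m B| <= (\sum_i \sum_j `|B i j|) * `|y|.
Proof.
apply: row_norm_le.
  by rewrite mulr_ge0// sumr_ge0// => i _; apply: sumr_ge0.
move=> j; rewrite mxE; apply: le_trans (ler_norm_sum _ _ _) _.
rewrite mulr_suml; apply: ler_sum => i _.
rewrite normrM mulrC; apply: ler_pM => //; last exact: row_coord_le.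
by rewrite (bigD1 j)//= lerDl sumr_ge0.
Qed.

Lemma banach_closed_ball (R : realType) (n : nat) (s : R)
    (f : 'rV[R]_n -> 'rV[R]_n) :
  0 <= s -> (forall x, `|x| <= s -> `|f x| <= s) ->
  (forall x y, `|x| <= s -> `|y| <= s -> `|f x - f y| <= 2^-1 * `|x - y|) ->
  exists2 x, `|x| <= s & x = f x.
Proof.
move=> s0 fs fc; pose U := [set x : 'rV[R]_n | `|x| <= s].
have fU : {homo f : x / U x >-> U x} by move=> x /fs.
have half0 : 0 <= 2^-1 :> R by rewrite invr_ge0.
apply: (@banach_fixed_point R 'rV[R]_n U (mkfun_fun fU)).
- exists (NngNum half0); split => /=; first lra.
  by move=> [x y] [/= xs ys]; exact: fc.
- rewrite (_ : U = (fun x : 'rV[R]_n => `|x|) @^-1` [set t | t <= s])//.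
  by apply: preimage_closed; [move=> x _; exact: norm_continuous|exact: closed_le].
- by exists 0; rewrite /U /= normr0.
Qed.

Lemma derive_lincomb (R : realType) (V W : normedModType R) (f : V -> W) (x : V)
    (n : nat) (c : 'I_n -> R) (e : 'I_n -> V) :
  differentiable f x ->
  'D_(\sum_k c k *: e k) f x = \sum_k c k *: 'D_(e k) f x.
Proof.
move=> df; rewrite deriveE// linear_sum; apply: eq_bigr => k _.
by rewrite linearZ deriveE.
Qed.

(** A C^1 map with a right inverse [B] of its differential at 0 is onto a
    neighbourhood of 0: restricted to the image of [B] it is the identity plus a
    map [Psi] of small Lipschitz constant, and y = b - Psi y has a solution by
    contraction. *)
Lemma local_surjection (R : realType) (m n : nat) (g : 'I_n -> 'rV[R]_m -> R)
    (B : 'M[R]_(n, m)) (W : set 'rV[R]_m) :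
  nbhs (0 : 'rV[R]_m) W ->
  (forall i p, W p -> differentiable (g i) p) ->
  (forall i v, {for 0, continuous ('D_v (g i))}) ->
  (forall i, g i 0 = 0) ->
  (forall i k, 'D_(row k B) (g i) 0 = (i == k)%:R) ->
  forall V, nbhs (0 : 'rV[R]_m) V ->
  exists2 beta : R, 0 < beta &
    forall b : 'I_n -> R, (forall i, `|b i| <= beta) ->
      exists2 p, V p & forall i, g i p = b i.
Proof.
move=> nW dg cg g0 gB V nV.
pose eta : R := (2 * n.+1%:R)^-1.
have eta0 : 0 < eta by rewrite invr_gt0 mulr_gt0.
have : \forall p \near (0 : 'rV[R]_m), [/\ V p, W p &
    forall i k, `|'D_(row k B) (g i) p - (i == k)%:R| <= eta].
  have near1 (ik : 'I_n * 'I_n) : \forall p \near (0 : 'rV[R]_m),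
      `|'D_(row ik.2 B) (g ik.1) p - (ik.1 == ik.2)%:R| <= eta.
    have /cvgrPdist_le/(_ _ eta0) := cg ik.1 (row ik.2 B).
    by rewrite /= gB; apply: filterS => p; rewrite distrC.
  have near_ik := @filter_forall _ _ _ (nbhs (0 : 'rV[R]_m)) _ near1.
  have nik : nbhs (0 : 'rV[R]_m) [set p | forall ik : 'I_n * 'I_n,
      `|'D_(row ik.2 B) (g ik.1) p - (ik.1 == ik.2)%:R| <= eta] by exact: near_ik.
  apply: filterS _ (filterI nV (filterI nW nik)) => p [Vp [Wp Dp]].
  by split=> // i k; exact: (Dp (i, k)).
move=> /nbhs_ballP[dl dl0 dlP].
pose M := (\sum_i \sum_j `|B i j|).
have M0 : 0 <= M by apply: sumr_ge0 => i _; apply: sumr_ge0.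
(* [M] bounds the norm of y |-> y B, which thus maps the ball of radius [s] into
   the ball of radius [dl]. *)
pose s := dl / 2 / (M + 1).
have M1 : 0 < M + 1 by rewrite ltr_wpDl.
have s0 : 0 < s by rewrite !divr_gt0.
have inball y : `|y| <= s -> [/\ V (y *m B), W (y *m B) &
    forall i k, `|'D_(row k B) (g i) (y *m B) - (i == k)%:R| <= eta].
  move=> ys; apply: dlP; rewrite -ball_normE /= sub0r normrN.
  apply: le_lt_trans (mulmx_norm_le _ _) _.
  apply: (@le_lt_trans _ _ ((M + 1) * s)).
    by apply: ler_pM => //; rewrite lerDl.
  by rewrite /s mulrC divfK ?gt_eqF// ltr_pdivrMr// ltr_pMr// ltr1n.
pose Psi (y : 'rV[R]_n) i : R := g i (y *m B) - y 0 i.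
have Psi_lip y y' i : `|y| <= s -> `|y'| <= s ->
    `|Psi y i - Psi y' i| <= 2^-1 * `|y - y'|.
  move=> ys y's; pose w := y - y'.
  pose phi t := g i (y' *m B + t *: (w *m B)) - (y' 0 i + t * w 0 i).
  pose dphi t := 'D_(w *m B) (g i) (y' *m B + t *: (w *m B)) - w 0 i.
  have segE t : y' *m B + t *: (w *m B) = (y' + t *: w) *m B.
    by rewrite (mulmxDl y' (t *: w) B); congr (_ + _); exact: scalemxAl.
  have seg (t : R) : t \in `[0, 1] -> `|y' + t *: w| <= s.
    rewrite in_itv/= => /andP[t0 t1].
    rewrite (_ : _ + _ = (1 - t) *: y' + t *: y); last first.
      by apply/rowP => j; rewrite /w !mxE; ring.
    apply: le_trans (ler_normD _ _) _; rewrite !normrZ.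
    rewrite (ger0_norm t0) ger0_norm; last lra.
    have : (1 - t) * `|y'| <= (1 - t) * s by apply: ler_wpM2l => //; lra.
    have : t * `|y| <= t * s by apply: ler_wpM2l.
    lra.
  have dPhi (t : R) : t \in `[0, 1] -> is_derive t 1 phi (dphi t).
    move=> t01; apply: is_deriveB.
      by apply: is_derive_line; rewrite segE; apply: dg; have [] := inball _ (seg t t01).
    by apply: is_derive_eq; rewrite /GRing.scale/=; ring.
  have cphi : {within `[0, 1], continuous phi}.
    by apply: derivable_within_continuous => t /dPhi dt; exact: ex_derive.
  have dphi' (t : R) : t \in `]0, 1[ -> is_derive t 1 phi (dphi t).
    by move=> t01; apply: dPhi; apply: subset_itv_oo_cc.
  have [t t01] := MVT ltr01 dphi' cphi.
  have -> : phi 1 = Psi y i.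
    by rewrite /phi segE scale1r mul1r /w !mxE !subrKC.
  have -> : phi 0 = Psi y' i by rewrite /phi scale0r mul0r !addr0.
  move=> ->; rewrite subr0 mulr1.
  have tcc : t \in `[0, 1] by apply: subset_itv_oo_cc.
  have [_ Wt Dt] := inball _ (seg t tcc).
  rewrite /dphi segE.
  have -> : 'D_(w *m B) (g i) ((y' + t *: w) *m B) =
      \sum_k w 0 k *: 'D_(row k B) (g i) ((y' + t *: w) *m B).
    have := @derive_lincomb R _ _ (g i) ((y' + t *: w) *m B) n (w 0)
      (fun k => row k B) (dg _ _ Wt).
    by move=> <-; congr ('D_ _ _ _); exact: mulmx_sum_row.
  rewrite (_ : w 0 i = \sum_k w 0 k * (i == k)%:R); last first.
    rewrite (bigD1 i)//= eqxx mulr1 big1 ?addr0// => k ki.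
    by rewrite eq_sym (negPf ki) mulr0.
  rewrite -sumrB; apply: le_trans (ler_norm_sum _ _ _) _.
  apply: (@le_trans _ _ (\sum_(k < n) `|w| * eta)).
    apply: ler_sum => k _; rewrite -mulrBr normrM.
    apply: ler_pM => //; first exact: row_coord_le.
  rewrite sumr_const card_ord -[_ *+ n]mulr_natl.
  rewrite (_ : n%:R * _ = (n%:R * eta) * `|w|); last by ring.
  apply: ler_wpM2r => //; rewrite /eta invfM mulrCA ler_piMr ?invr_ge0//.
  by rewrite ler_pdivrMr// mul1r ler_nat.
exists (s / 2); first by rewrite divr_gt0.
move=> b bs; pose Phi (y : 'rV[R]_n) : 'rV[R]_n := \row_i (b i - Psi y i).
have Psi0 i : Psi 0 i = 0 by rewrite /Psi mul0mx g0 mxE subr0.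
have [|x y xs ys|y ys yE] := @banach_closed_ball R n s Phi (ltW s0).
- move=> x xs; apply: row_norm_le; first exact: ltW.
  move=> i; rewrite mxE; apply: le_trans (ler_normB _ _) _.
  have := Psi_lip x 0 i xs; rewrite normr0 Psi0 !subr0 => /(_ (ltW s0)).
  by have := bs i; lra.
- apply: row_norm_le; first by rewrite mulr_ge0.
  move=> i; have -> : (Phi x - Phi y) 0 i = - (Psi x i - Psi y i).
    by rewrite !mxE; ring.
  by rewrite normrN; exact: Psi_lip.
have [Vy _ _] := inball y ys.
exists (y *m B) => // i.
move/(congr1 (fun z : 'rV[R]_n => z 0 i)): yE.
by rewrite mxE /Psi; lra.
Qed.

(** [central_coeffs] is built from one-variable derivatives and is only known to
    be smooth through a local expression; a Jacobian has a meaning only for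
    differentiable maps, so differentiability itself must be transferred. *)
Lemma near_eq_differentiable (R : realType) (V W : normedModType R) (f g : V -> W)
    (x : V) :
  {near x, f =1 g} -> differentiable f x -> differentiable g x.
Proof.
move=> fg df; have [dc dE] := (diff_locallyP _ _).1 df.
have gE : g \o shift x = cst (g x) + 'd f x +o_ 0 id.
  apply/eqaddoP => e e0.
  have fg0 : \forall h \near (0 : V), f (h + x) = g (h + x).
    have := fg; rewrite (near_shift 0 x); apply: filterS => h /=.
    by rewrite subr0.
  have := iffLR (eqaddoP _ _ _ _) dE e e0; apply: filterS2 fg0 => h /= fgh.
  by rewrite !fctE /= -fgh -(nbhs_singleton fg).
have E : 'd g x = 'd f x :> (V -> W) by apply: diff_unique.
by apply/diff_locallyP; rewrite E.
Qed.

Lemma near_eq_continuous_at (T U : topologicalType) (f g : T -> U) (x : T) :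
  {near x, f =1 g} -> {for x, continuous f} -> {for x, continuous g}.
Proof.
move=> fg; rewrite /prop_for /continuous_at -(nbhs_singleton fg).
by apply: cvg_trans; apply: near_eq_cvg; apply: filterS fg.
Qed.

(** Equivalently, the jet of order n - 1 of q |-> S(q, p, 0) at 0 can be prescribed
    freely, by p in a given neighbourhood, as long as it is small. *)
Lemma central_surjection (R : realType) (m k n : nat)
    (S : R * ('rV[R]_m * 'rV[R]_k) -> R) :
  Ck_near n.+1 0 S -> (forall j, (j < n)%N -> dq j S 0 = 0) ->
  \rank ('J (central_coeffs n S) 0) = n ->
  forall V : set 'rV[R]_m, nbhs 0 V ->
  exists2 beta : R, 0 < beta &
    forall b : nat -> R, (forall j, (j < n)%N -> `|b j| <= beta) ->
      exists2 p, V p &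
        forall j, (j < n)%N -> dqn j S (0, (p, 0)) = j`!%:R * b j.
Proof.
move=> [U [oU U0] CS] flat rk V nV.
pose emb (p : 'rV[R]_m) : R * ('rV[R]_m * 'rV[R]_k) := (0, (p, 0)).
have demb p : differentiable emb p.
  apply: differentiable_pair; first exact: differentiable_cst.
  apply: differentiable_pair; last exact: differentiable_cst.
  exact: ex_diff.
have cemb : continuous emb by move=> p; exact: differentiable_continuous.
pose W := emb @^-1` U.
have nW : nbhs (0 : 'rV[R]_m) W.
  by apply: cemb; apply: open_nbhs_nbhs; split.
have dS j p : (j < n)%N -> W p -> differentiable (dqn j S) (emb p).
  move=> jn Wp; have := Ck_dqn CS (leqW (ltnW jn)).
  rewrite (_ : (n.+1 - j = (n - j).+1)%N); last lia.
  by move=> [df _]; apply: df; exact: mem_set.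
have cS j v : (j < n)%N -> {for emb 0, continuous ('D_v (dqn j S))}.
  move=> jn; have := Ck_dqn CS (leqW (ltnW jn)).
  rewrite (_ : (n.+1 - j = (n - j).+1)%N); last lia.
  by move=> [_ /(_ v) /Ck_continuous]; apply; exact: mem_set.
pose g (j : 'I_n) (p : 'rV[R]_m) : R := (j`!%:R)^-1 * dqn j S (emb p).
have dg j p : W p -> differentiable (g j) p.
  move=> Wp; apply: differentiableZ.
  by apply: (@differentiable_comp _ _ _ _ emb (dqn j S)); last exact: dS.
have Dg j v p : W p ->
    'D_v (g j) p = (j`!%:R)^-1 * 'D_(0, (v, 0)) (dqn j S) (emb p).
  move=> Wp; rewrite -[RHS]/(_ *: _).
  rewrite -deriveZ; last exact: (diff_derivable (dS _ _ (ltn_ord j) Wp)).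
  have embD h : emb (h *: v + p) = h *: (0, (v, 0)) + emb p.
    by congr (_, (_, _)); rewrite /= scaler0 addr0.
  have E : (fun h : R => h^-1 *: (g j (h *: v + p) - g j p)) =
      (fun h : R => h^-1 *: (((j`!%:R)^-1 *: dqn j S) (h *: (0, (v, 0)) + emb p)
         - ((j`!%:R)^-1 *: dqn j S) (emb p))).
    by apply/funext => h; rewrite /g embD.
  by rewrite /derive E.
have cg j v : {for 0, continuous ('D_v (g j))}.
  have cR : {for 0, continuous (fun p : 'rV[R]_m =>
      (j`!%:R)^-1 * 'D_(0, (v, 0)) (dqn j S) (emb p))}.
    apply: continuousM; first exact: cst_continuous.
    exact: (@continuous_comp _ _ _ emb ('D_(0, (v, 0)) (dqn j S)) 0 (cemb 0)
      (cS _ _ (ltn_ord j))).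
  have nE : \forall p \near (0 : 'rV[R]_m),
      (j`!%:R)^-1 * 'D_(0, (v, 0)) (dqn j S) (emb p) = 'D_v (g j) p.
    by apply: filterS nW => p Wp; rewrite Dg.
  exact: near_eq_continuous_at nE cR.
have dqE j p : (j < n)%N -> W p -> dq j S (p, 0) = dqn j S (emb p).
  by move=> jn Wp; apply: (derive1n_slice oU CS _ Wp); exact: leqW (ltnW jn).
have g0 j : g j 0 = 0.
  rewrite /g -dqE ?flat ?mulr0//; exact: nbhs_singleton nW.
pose G (p : 'rV[R]_m) : 'rV[R]_n := \row_j g j p.
have GE : {near (0 : 'rV[R]_m), G =1 central_coeffs n S}.
  by apply: filterS nW => p Wp; apply/rowP => j; rewrite !mxE dqE// mulrC.
have dG : differentiable G 0.
  rewrite (_ : G = \sum_(j < n) (fun p => g j p *: (delta_mx 0 j : 'rV[R]_n))).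
    apply: differentiable_sum => j; apply: differentiableZl.
    by apply: dg; exact: nbhs_singleton nW.
  apply/funext => p; rewrite fct_sumE.
  by rewrite {1}[G p]row_sum_delta; apply: eq_bigr => j _; rewrite mxE.
have dcc := near_eq_differentiable GE dG.
have /row_fullP[B BJ] : row_full ('J (central_coeffs n S) 0).
  by rewrite /row_full rk.
have gB (i l : 'I_n) : 'D_(row l B) (g i) 0 = (i == l)%:R.
  have := deriveEjacobian (row l B) dcc.
  rewrite -(near_eq_derive _ GE) derive_mx; last exact: diff_derivable.
  rewrite -row_mul BJ => /rowP/(_ i); rewrite !mxE eq_sym => <-.
  have -> : (fun p => G p 0 i) = g i by apply/funext => p; rewrite mxE.
  by [].
have [beta beta0 surj] := local_surjection nW dg cg g0 gB nV.
exists beta => // b bb.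
have [|p Vp pE] := surj (fun j => b j); first by move=> i; exact: bb.
exists p => // j jn; have := pE (Ordinal jn); rewrite /g /= => <-.
by rewrite mulVKf// pnatr_eq0 -lt0n fact_gt0.
Qed.

(** * The upper bound *)

(** Multiplication of F by the sign of [delta] reduces the claim to a positive
    coefficient of the cap; the sign of c delta becomes that of the n-th
    derivative of the smooth part. *)
Lemma cap_zero_bound (R : realType) (n nu : nat)
    (a r top eps B rho delta c : R) (u : 'rV[R]_(nu - 2)) (s : nat -> R -> R)
    (Fl : R -> R) :
  (2 <= n)%N -> (2 <= nu)%N -> 0 < a -> 0 < r -> 0 < eps -> rho <= top ->
  (forall x y, x \in `[- r, r] -> y \in `[- r, r] ->
     `|(potential a u).[y] - (potential a u).[x]| <= eps * `|y - x|) ->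
  (forall t, r <= `|t| -> top <= (potential a u).[t]) ->
  B * eps < `|delta| ->
  (forall j, (j < n)%N -> forall z, z \in `]- rho, rho[ ->
     is_derive z 1 (s j) (s j.+1 z)) ->
  (forall z, z \in `]- rho, rho[ -> `|s 2%N z| <= B) ->
  (forall z, z \in `]- rho, rho[ -> 0 < c * s n z) ->
  (forall z, z \in `]- rho, rho[ -> Fl z = s 0%N z + delta * cap nu a z u) ->
  delta != 0 ->
  finite_set [set q | [set` `]- rho, rho[] q /\ Fl q = 0] /\
  (Niso Fl `](- rho)%R, rho[ <= (if (0 < c * delta)%R then n else n.+1)%:R%:E)%E.
Proof.
move=> n2 nu2 a0 r0 eps0 rt lip coer Bd sd s2 sn FE d0.
apply: Niso_le => x xU xS x0.
set P := horner (potential a u) in lip coer.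
have cP : continuous P by exact: continuous_horner.
pose m := sublength P r.
pose sg := Num.sg delta.
have sg2 : sg * sg = 1 by rewrite /sg -expr2 sqr_sg d0.
have dE : `|delta| = sg * delta by rewrite /sg normrEsg.
pose f j z := sg * s j z.
pose G z := f 0%N z + `|delta| * cap nu a z u.
have GF z : z \in `]- rho, rho[ -> G z = sg * Fl z.
  by move=> zI; rewrite FE// /G dE /f; ring.
have fd j : (j < n)%N -> forall z, z \in `]- rho, rho[ ->
    is_derive z 1 (f j) (f j.+1 z).
  move=> jn z zI; have ? := sd j jn z zI.
  exact: (@is_deriveZ _ _ _ (s j) sg z 1).
have Gd z : z \in `]- rho, rho[ -> is_derive z 1 G (f 1%N z + `|delta| * m z).
  move=> zI; have ? := fd 0%N (ltnW n2) z zI.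
  have zt : z < top by move: zI; rewrite in_itv/= => /andP[_ z1]; exact: lt_le_trans rt.
  have dcap : is_derive z 1 (cap nu a ^~ u) (m z) := is_derive_cap nu2 a0 coer zt.
  have -> : G = (f 0%N) + `|delta| *: (cap nu a ^~ u) :> (R -> R) by [].
  by apply: is_deriveD; exact: (@is_deriveZ _ _ _ (cap nu a ^~ u) `|delta| z 1).
have m0 z : 0 <= m z by exact: sublength_ge0.
have m_nd y z : y <= z -> m y <= m z by exact: sublength_nd.
have steep y z : y \in `]- rho, rho[ -> z \in `]- rho, rho[ -> y < z -> 0 < m y ->
    f 1%N y - f 1%N z < `|delta| * (m z - m y).
  move=> yI zI yz my.
  have ztop : z <= P r.
    apply: (@le_trans _ _ top); last by apply: coer; rewrite ger0_norm// ltW.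
    by move: zI; rewrite in_itv/= => /andP[_ z1]; apply: le_trans (ltW z1) rt.
  have st := sublength_steep cP eps0 lip ztop yz my.
  have [t tI fE] := MVT_within (fd 1%N n2) yI zI yz.
  have tI' : t \in `]- rho, rho[.
    move: tI yI zI; rewrite !in_itv/= => /andP[? ?] /andP[? ?] /andP[? ?].
    by apply/andP; split; lra.
  have : `|f 2%N t| <= B.
    by rewrite /f normrM /sg normr_sg d0 mul1r; exact: s2.
  rewrite ler_norml => /andP[fB _].
  have zy0 : 0 < z - y by rewrite subr_gt0.
  have B0 : 0 <= B := le_trans (normr_ge0 _) (s2 _ tI').
  have mm : 0 < m z - m y.
    by rewrite -(pmulr_rgt0 _ eps0); apply: lt_le_trans st.
  have l1 : f 1%N y - f 1%N z <= B * (z - y).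
    rewrite -opprB fE -mulNr; apply: ler_wpM2r; first exact: ltW.
    by rewrite lerNl.
  apply: le_lt_trans l1 _.
  apply: (@le_lt_trans _ _ (B * (eps * (m z - m y)))); first exact: ler_wpM2l.
  by rewrite mulrA ltr_pM2r.
have Gx i K : (i <= K)%N -> (forall j, (j <= K)%N -> [set` `]- rho, rho[] (x j)) ->
    (forall j, (j <= K)%N -> Fl (x j) = 0) -> G (x i) = 0.
  by move=> iK xK FK; rewrite GF ?FK ?mulr0//; exact: xK.
have fn z : z \in `]- rho, rho[ -> f n z * `|delta| = s n z * delta.
  by move=> _; rewrite /f dE mulrACA sg2 mul1r.
have nd0 : 0 < `|delta| by rewrite normr_gt0.
move: xU xS x0; case: ifPn => cd xU xS x0.
  apply: (@no_extra_zero_same_sign R (- rho) rho `|delta| f m G n x) => //.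
  - by move=> j /andP[_ jn]; exact: fd.
  - move=> z zI; rewrite -(pmulr_lgt0 _ nd0) fn//.
    have := mulr_gt0 (sn z zI) cd; rewrite mulrACA pmulr_rgt0//.
    by rewrite -expr2 exprn_even_gt0//=; apply/eqP => c0; move: cd; rewrite c0 mul0r ltxx.
  - by move=> i iN; apply: (Gx i n).
apply: (@no_extra_zero_opposite_sign R (- rho) rho `|delta| f m G n x) => //.
- by move=> j /andP[_ jn]; exact: fd.
- move=> z zI; rewrite -(pmulr_llt0 _ nd0) fn//.
  have c0 : c != 0 by apply/eqP => c0; have := sn z zI; rewrite c0 mul0r ltxx.
  have cd' : c * delta < 0.
    by rewrite lt_neqAle mulf_neq0// leNgt.
  have : (c * s n z) * (c * delta) < 0 by rewrite pmulr_rlt0//; exact: sn.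
  by rewrite mulrACA pmulr_rlt0// -expr2 exprn_even_gt0.
- by move=> i iN; apply: (Gx i n.+1).
Qed.

(** * Realising the bound for u = 0 *)

(** A Taylor estimate for the difference f 0 - T, whose derivatives at 0 vanish up
    to order n - 1: each application of the mean value theorem gains one power
    of |z|. *)
Lemma taylor_comparison (R : realType) (a b eta : R) (n : nat) :
  a < 0 -> 0 < b ->
  forall (f : nat -> R -> R) (T : {poly R}),
  (forall j, (j < n)%N -> forall z, z \in `]a, b[ ->
     is_derive z 1 (f j) (f j.+1 z)) ->
  (forall j, (j < n)%N -> f j 0 = (T^`(j)).[0]) ->
  (forall z, z \in `]a, b[ -> `|f n z - (T^`(n)).[z]| <= eta) ->
  forall z, z \in `]a, b[ -> `|f 0%N z - T.[z]| <= eta * `|z| ^+ n.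
Proof.
move=> a0 b0; have I0 : 0 \in `]a, b[ by rewrite in_itv/= a0.
elim: n => [|n IH] f T fd f0 fn z zI; first by rewrite expr0 mulr1; exact: fn.
have IH1 : forall t, t \in `]a, b[ -> `|f 1%N t - (T^`()).[t]| <= eta * `|t| ^+ n.
  apply: (IH (fun j => f j.+1) T^`()).
  - by move=> j jn; apply: fd.
  - by move=> j jn; rewrite f0// derivSn.
  - by move=> t tI; rewrite -derivSn; exact: fn.
pose g t := f 0%N t - T.[t].
have gd t : t \in `]a, b[ -> is_derive t 1 g (f 1%N t - (T^`()).[t]).
  by move=> tI; have ? := fd 0%N isT t tI; exact: is_deriveB.
have g0 : g 0 = 0 by rewrite /g f0// derivn0 subrr.
suff [t tI [tz gE]] : exists2 t, t \in `]a, b[ & `|t| <= `|z| /\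
    g z = (f 1%N t - (T^`()).[t]) * z.
  rewrite -/(g z) gE normrM exprSr mulrA; apply: ler_wpM2r => //.
  apply: le_trans (IH1 t tI) _; apply: ler_wpM2l.
    apply: le_trans (normr_ge0 _) (fn 0 I0).
  by apply: lerXn2r; rewrite ?nnegrE.
have [z0|z0|->] := ltrgtP z 0.
- have [t] := MVT_within gd zI I0 z0.
  rewrite in_itv/= g0 !sub0r => /andP[zt t0] E; exists t.
    by move: zI; rewrite !in_itv/= => /andP[? ?]; apply/andP; split; lra.
  split; first by rewrite !ltr0_norm//; lra.
  by apply: oppr_inj; rewrite E mulrN.
- have [t] := MVT_within gd I0 zI z0.
  rewrite in_itv/= g0 !subr0 => /andP[t0 tz] E; exists t => //.
    by move: zI; rewrite !in_itv/= => /andP[? ?]; apply/andP; split; lra.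
  by split => //; rewrite !gtr0_norm//; lra.
- by exists 0 => //; rewrite g0 mulr0.
Qed.

(** The product of the X + (i + 1) e for i < n, with roots at -e, ..., -n e. *)
Definition comb_poly (R : realType) (n : nat) (e : R) : {poly R} :=
  \prod_(i < n) ('X - (- (i.+1%:R * e))%:P).

Lemma size_comb_poly (R : realType) (n : nat) (e : R) :
  size (comb_poly n e) = n.+1.
Proof. by rewrite /comb_poly size_prod_XsubC /index_enum -enumT size_enum_ord. Qed.

Lemma lead_comb_poly (R : realType) (n : nat) (e : R) : (comb_poly n e)`_n = 1.
Proof.
have /monicP : comb_poly n e \is monic by exact: monic_prod_XsubC.
by rewrite /lead_coef size_comb_poly.
Qed.

Lemma comb_poly_coef_small (R : realType) (n : nat) :
  exists2 C : R, 0 <= C & forall e, 0 < e -> e <= 1 ->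
    forall j, (j < n)%N -> `|(comb_poly n e)`_j| <= C * e.
Proof.
elim: n => [|n [C C0 IH]]; first by exists 0.
exists (C + (C + 1) * n.+1%:R).
  by rewrite addr_ge0// mulr_ge0// addr_ge0.
move=> e e0 e1 j; rewrite ltnS => jn.
have le1 : `|(comb_poly n e)`_j| <= C + 1.
  move: jn; rewrite leq_eqVlt => /predU1P[->|jn].
    by rewrite lead_comb_poly normr1 lerDr.
  by apply: le_trans (IH e e0 e1 j jn) _; nra.
rewrite /comb_poly big_ord_recr -/(comb_poly n e) /=.
rewrite mulrBr coefB coefMX coefMC.
apply: le_trans (ler_normB _ _) _; rewrite mulrDl; apply: lerD.
  case: j jn {le1} => [|j] jn /=; first by rewrite normr0 mulr_ge0// ltW.
  exact: IH.
rewrite normrM normrN (ger0_norm (mulr_ge0 _ (ltW e0)))// mulrA.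
by apply: ler_wpM2r; [exact: ltW|apply: ler_wpM2r].
Qed.

(** At - (i + 1/2) e each factor has absolute value at least e / 2, and exactly
    [minn i n] of the factors are negative. *)
Lemma comb_poly_signs (R : realType) (n i : nat) (e : R) : 0 < e ->
  (e / 2) ^+ n <= (-1) ^+ minn i n * (comb_poly n e).[- ((i%:R + 2^-1) * e)].
Proof.
move=> e0; elim: n => [|n IH].
  by rewrite minn0 /comb_poly big_ord0 hornerC mulr1.
rewrite /comb_poly big_ord_recr -/(comb_poly n e) /= hornerM hornerXsubC.
have fE : - ((i%:R + 2^-1) * e) - - (n.+1%:R * e) = (n%:R - i%:R + 2^-1) * e.
  by rewrite -natr1; field.
rewrite fE exprSr.
have e2 : 0 <= (e / 2) ^+ n by rewrite exprn_ge0// divr_ge0// ltW.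
have [ni|ni] := ltnP n i.
  have nE : minn i n = n by lia.
  rewrite (_ : minn i n.+1 = n.+1); last lia.
  move: IH; rewrite nE => IH.
  have n1i : n%:R + 1 <= i%:R :> R by rewrite natr1 ler_nat.
  have : e / 2 <= - ((n%:R - i%:R + 2^-1) * e) by nra.
  set g := (_ * e); set Q := _.[_] in IH *; move=> H.
  rewrite (_ : _ * (Q * g) = ((-1) ^+ n * Q) * - g); last by rewrite exprSr; ring.
  by apply: ler_pM => //; rewrite divr_ge0// ltW.
have nE : minn i n = i by lia.
rewrite (_ : minn i n.+1 = i); last lia.
move: IH; rewrite nE => IH.
have n1i : i%:R <= n%:R :> R by rewrite ler_nat.
have : e / 2 <= (n%:R - i%:R + 2^-1) * e by nra.
by move=> H; rewrite [leRHS]mulrA; apply: ler_pM => //; rewrite divr_ge0// ltW.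
Qed.

Lemma derivn_comb_poly0 (R : realType) (n j : nat) (c e : R) :
  ((c *: comb_poly n e)^`(j)).[0] = j`!%:R * (c * (comb_poly n e)`_j).
Proof.
by rewrite horner_coef0 coef_derivn addn0 ffactnn coefZ mulr_natl.
Qed.

Lemma derivn_comb_poly (R : realType) (n : nat) (c e z : R) :
  ((c *: comb_poly n e)^`(n)).[z] = n`!%:R * c.
Proof.
rewrite (_ : _^`(n) = (n`!%:R * c)%:P) ?hornerC//.
apply/polyP => -[|i]; rewrite coef_derivn coefZ coefC /=.
  by rewrite addn0 ffactnn lead_comb_poly mulr1 mulr_natl.
by rewrite nth_default ?mulr0 ?mul0rn// size_comb_poly; lia.
Qed.

(** At the midpoints between the roots both the polynomial and the admissible error
    scale like e^n, so the condition on [eta] does not involve e. *)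
Lemma comb_oscillation (R : realType) (n : nat) (c eta e : R) (f : R -> R) (i : nat) :
  0 < e -> 0 <= eta -> c != 0 -> eta * n.+1%:R ^+ n < `|c| / 2 ^+ n -> (i <= n)%N ->
  (let z := - ((i%:R + 2^-1) * e) in
   `|f z - (c *: comb_poly n e).[z]| <= eta * `|z| ^+ n) ->
  0 < (-1) ^+ i * (c * f (- ((i%:R + 2^-1) * e))).
Proof.
move=> e0 eta0 c0 etac iN; set z := - _ => /= close.
have := @comb_poly_signs R n i e e0; rewrite (_ : minn i n = i); last lia.
rewrite -/z => signs.
have zle : `|z| <= n.+1%:R * e.
  rewrite /z normrN ger0_norm; last by rewrite mulr_ge0 ?addr_ge0 ?invr_ge0// ltW.
  apply: ler_wpM2r; first exact: ltW.
  have : i%:R <= n%:R :> R by rewrite ler_nat.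
  by rewrite -(natr1 n); lra.
have err : `|c| * `|f z - (c *: comb_poly n e).[z]| < c ^+ 2 * (e / 2) ^+ n.
  have nc : 0 < `|c| by rewrite normr_gt0.
  have -> : c ^+ 2 = `|c| * `|c| by rewrite -normrM -expr2 ger0_norm ?sqr_ge0.
  rewrite -mulrA ltr_pM2l//.
  apply: le_lt_trans close _.
  apply: (@le_lt_trans _ _ (eta * (n.+1%:R * e) ^+ n)).
    by apply: ler_wpM2l => //; apply: lerXn2r; rewrite ?nnegrE// mulr_ge0// ltW.
  rewrite !exprMn exprVn mulrA [e ^+ n / _]mulrC mulrA.
  by rewrite ltr_pM2r ?exprn_gt0.
have -> : (-1) ^+ i * (c * f z) = c ^+ 2 * ((-1) ^+ i * (comb_poly n e).[z]) +
    (-1) ^+ i * (c * (f z - (c *: comb_poly n e).[z])).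
  by rewrite hornerZ; ring.
have l1 : c ^+ 2 * (e / 2) ^+ n <= c ^+ 2 * ((-1) ^+ i * (comb_poly n e).[z]).
  by apply: ler_wpM2l => //; exact: sqr_ge0.
set E := (-1) ^+ i * (c * _) in |- *.
have : `|E| = `|c| * `|f z - (c *: comb_poly n e).[z]|.
  by rewrite /E normrM normrX normrN1 expr1n mul1r normrM.
have := ler_norm (- E); rewrite normrN; lra.
Qed.

Lemma sub_symmetric_itv (R : realType) (r s x : R) :
  r <= s -> x \in `]- r, r[ -> x \in `]- s, s[.
Proof. by move=> rs; rewrite !in_itv/= => /andP[? ?]; apply/andP; split; lra. Qed.

Lemma natr_half_le (R : realType) (i n : nat) :
  (i <= n)%N -> i%:R + 2^-1 <= n.+1%:R :> R.
Proof.
move=> iN; have : i%:R <= n%:R :> R by rewrite ler_nat.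
by rewrite -(natr1 n); lra.
Qed.

Lemma mem_symmetric_itv (R : realType) (r x : R) :
  `|x| < r -> x \in `]- r, r[.
Proof. by rewrite in_itv/= ltr_norml. Qed.

Lemma opposite_signs (R : realType) (c x y : R) (k : nat) :
  0 < (-1) ^+ k.+1 * (c * x) -> 0 < (-1) ^+ k * (c * y) -> x * y < 0.
Proof.
move=> cx cy; have := mulr_gt0 cx cy.
have -> : (-1) ^+ k.+1 * (c * x) * ((-1) ^+ k * (c * y)) =
    - ((-1) ^+ k * (-1) ^+ k * (c ^+ 2 * (x * y))) by rewrite exprS; ring.
rewrite -exprMn mulrNN mulr1 expr1n mul1r oppr_gt0 pmulr_rlt0//.
rewrite exprn_even_gt0//=; apply/eqP => c0.
by move: cx; rewrite c0 mul0r mulr0 ltxx.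
Qed.

Lemma comb_zeros (R : realType) (n N : nat) (c e rho q1 : R) (G : R -> R) :
  0 < e -> n.+1%:R * e < rho ->
  (forall t, t \in `]- rho, rho[ -> derivable G t 1) ->
  (forall i, (i <= n)%N -> 0 < (-1) ^+ i * (c * G (- ((i%:R + 2^-1) * e)))) ->
  N = n \/ [/\ N = n.+1, 0 < q1, q1 < rho & c * G q1 < 0] ->
  exists x : nat -> R,
    [/\ forall i, (i < N)%N -> x i \in `]- rho, rho[,
        forall i, (i.+1 < N)%N -> x i < x i.+1 &
        forall i, (i < N)%N -> G (x i) = 0].
Proof.
move=> e0 er dG signs NE.
(* In increasing order: the midpoints -(n + 1/2) e, ..., -e/2, and then q1. *)
pose z (i : nat) : R := if (i <= n)%N then - (((n - i)%N%:R + 2^-1) * e) else q1.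
have half : 0 < 2^-1 :> R by rewrite invr_gt0.
have zneg i : (i <= n)%N -> - rho < z i /\ z i < 0.
  move=> iN; rewrite /z iN.
  have : (n - i)%N%:R <= n%:R :> R by rewrite ler_nat leq_subr.
  have : 0 <= (n - i)%N%:R :> R by [].
  move: (n - i)%N => k k0 kn; split; last first.
    by rewrite oppr_lt0 mulr_gt0// ltr_wpDl.
  rewrite ltrN2; apply: le_lt_trans er; apply: ler_wpM2r; first exact: ltW.
  by rewrite -(natr1 n); lra.
apply: (@sign_changes R (- rho) rho G N z dG).
- move=> i iN; rewrite in_itv/=; have [iln|iln] := leqP i n.
    by have [? ?] := zneg i iln; apply/andP; split; lra.
  case: NE => [NE|[NE q10 q1r _]]; first lia.
  by rewrite /z leqNgt iln /=; apply/andP; split; lra.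
- move=> i iN; have [iln|iln] := leqP i.+1 n.
    rewrite /z iln (ltnW iln) ltrN2 ltr_pM2r// ltrD2r ltr_nat; lia.
  case: NE => [NE|[NE q10 _ _]]; first lia.
  have [_ zi0] := zneg i ltac:(lia).
  by apply: lt_trans zi0 _; rewrite /z leqNgt iln.
- move=> i iN; have [iln|iln] := leqP i.+1 n.
    rewrite /z iln (ltnW iln).
    have s2 := signs (n - i.+1)%N (leq_subr _ _).
    have := signs (n - i)%N (leq_subr _ _).
    rewrite (_ : (n - i = (n - i.+1).+1)%N); last lia.
    by move=> s1; exact: opposite_signs s1 s2.
  case: NE => [NE|[NE q10 _ cG]]; first lia.
  have -> : i = n by lia.
  rewrite /z leqnn ltnn subnn.
  have := signs 0%N isT; rewrite expr0 mul1r => cG0.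
  rewrite mulrC; apply: (@opposite_signs R c _ _ 0).
    by rewrite expr1 mulN1r oppr_gt0.
  by rewrite expr0 mul1r.
Qed.

Lemma comb_poly_le (R : realType) (n : nat) (e q : R) :
  0 < e -> 0 <= q -> n%:R * e <= q -> `|(comb_poly n e).[q]| <= (2 * q) ^+ n.
Proof.
move=> e0 q0 neq; rewrite /comb_poly horner_prod normr_prod.
rewrite -[leRHS](_ : \prod_(i < n) (2 * q) = _); last by rewrite prodr_const card_ord.
apply: ler_prod => i _; rewrite normr_ge0 /= hornerXsubC opprK.
have ie : i.+1%:R * e <= n%:R * e by rewrite ler_pM2r// ler_nat.
have ie0 : 0 <= i.+1%:R * e by rewrite mulr_ge0// ltW.
by rewrite ger0_norm; lra.
Qed.

(** At [q1] both c [comb_poly] and the error are O(q1^n), thus O(q1^2) as n >= 2,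
    with constant |c| 2^n + eta; [L] exceeds what is needed to beat it, also after
    d has been halved by the perturbation of the parameters. *)
Lemma cap_dominates (R : realType) (n : nat) (c d0 dl eta e q1 L C Sq : R) :
  (2 <= n)%N -> 0 < e -> 0 < q1 -> q1 <= 1 -> n%:R * e <= q1 -> 0 <= eta ->
  c * d0 < 0 -> `|dl - d0| < `|d0| / 2 ->
  L = 2 * (`|c| * 2 ^+ n + eta + 1) / `|d0| -> L * q1 ^+ 2 <= C ->
  `|Sq - (c *: comb_poly n e).[q1]| <= eta * `|q1| ^+ n ->
  c * (Sq + dl * C) < 0.
Proof.
move=> n2 e0 q0 q1le neq eta0 cd0 dld0 LE LC close.
have nd0 : 0 < `|d0|.
  by rewrite normr_gt0; apply/eqP => d00; move: cd0; rewrite d00 mulr0 ltxx.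
have nc : 0 < `|c|.
  by rewrite normr_gt0; apply/eqP => c0; move: cd0; rewrite c0 mul0r ltxx.
pose M := `|c| * 2 ^+ n + eta.
have M0 : 0 <= M by rewrite addr_ge0// mulr_ge0// exprn_ge0.
have q2 : q1 ^+ n <= q1 ^+ 2 by apply: ler_wiXn2l => //; exact: ltW.
have S_le : `|Sq| <= M * q1 ^+ 2.
  apply: (@le_trans _ _ (M * q1 ^+ n)); last exact: ler_wpM2l.
  have := comb_poly_le e0 (ltW q0) neq; rewrite exprMn => cl.
  have tr := ler_normD (Sq - (c *: comb_poly n e).[q1]) (c *: comb_poly n e).[q1].
  rewrite subrK in tr; apply: le_trans tr _.
  rewrite /M mulrDl addrC; apply: lerD; last by rewrite -[X in _ * X ^+ _](gtr0_norm q0).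
  by rewrite hornerZ normrM -mulrA ler_pM2l.
have cdl : c * dl <= - (`|c| * (`|d0| / 2)).
  move: dld0; rewrite ltr_norml => /andP[h1 h2].
  have [d0p|d0n|d00] := ltrgtP 0 d0; last by move: nd0; rewrite -d00 normr0 ltxx.
    have cn : c < 0 by rewrite -(pmulr_llt0 _ d0p).
    by rewrite (ltr0_norm cn) (gtr0_norm d0p) in h1 h2 *; nra.
  have cp : 0 < c by rewrite -(nmulr_llt0 _ d0n).
  by rewrite (gtr0_norm cp) (ltr0_norm d0n) in h1 h2 *; nra.
have q22 : 0 < q1 ^+ 2 by rewrite exprn_gt0.
have LE' : L * (`|d0| / 2) = M + 1 by rewrite LE /M; field; rewrite gt_eqF.
have C0 : 0 <= C.
  apply: le_trans LC; apply: mulr_ge0; last exact: ltW.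
  by rewrite LE mulr_ge0 ?invr_ge0// mulr_ge0// addr_ge0.
have cS : c * Sq <= `|c| * (M * q1 ^+ 2).
  by apply: le_trans (ler_norm _) _; rewrite normrM ler_pM2l.
have h1 : c * dl * C <= - (`|c| * (`|d0| / 2)) * C by apply: ler_wpM2r.
have h2 : (`|c| * (`|d0| / 2)) * (L * q1 ^+ 2) <= (`|c| * (`|d0| / 2)) * C.
  by apply: ler_wpM2l => //; rewrite mulr_ge0// divr_ge0.
have h3 : (`|c| * (`|d0| / 2)) * (L * q1 ^+ 2) = `|c| * ((M + 1) * q1 ^+ 2).
  by rewrite -LE'; ring.
have h4 : 0 < `|c| * q1 ^+ 2 by rewrite mulr_gt0.
rewrite mulrDr mulrA; move: h1; rewrite mulNr.
have : `|c| * ((M + 1) * q1 ^+ 2) = `|c| * (M * q1 ^+ 2) + `|c| * q1 ^+ 2 by ring.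
lra.
Qed.

(** * The cyclicity theorem *)

Unset Implicit Arguments.
Set Strict Implicit.
Set Printing Implicit Defensive.

Theorem theorem7p2 (R : realType) (n m nu : nat) (a : R)
    (n_ge2 : (2 <= n)%N) (nu_ge4 : (4 <= nu)%N) (nu_even : ~~ odd nu)
    (a_gt0 : 0 < a)
    (S : R * ('rV[R]_m * 'rV[R]_(nu - 2)) -> R)
    (d : 'rV[R]_m * 'rV[R]_(nu - 2) -> R)
    (F : R -> 'rV[R]_m * 'rV[R]_(nu - 2) -> R)
    (rho0 : R) (V0 : set ('rV[R]_m * 'rV[R]_(nu - 2)))
    (rho0_gt0 : 0 < rho0) (V0_nbhs : nbhs (0 : 'rV[R]_m * 'rV[R]_(nu - 2)) V0)
    (F_def : \forall z \near (0 : R * ('rV[R]_m * 'rV[R]_(nu - 2))),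
       F z.1 z.2 = S z + d z.2 * cap nu a z.1 z.2.2)
    (S_smooth : Ck_near n.+1 0 S) (d_smooth : Ck_near 2 0 d)
    (S_flat : forall j : nat, (j < n)%N -> dq j S 0 = 0)
    (c : R) (c_def : c = dq n S 0 / n`!%:R) (c_neq0 : c != 0)
    (d0_neq0 : d 0 != 0) :
  let N := if 0 < c * d 0 then n else n.+1 in
  [/\ (Cyc rho0 V0 F <= N%:R%:E)%E,
      \rank ('J (central_coeffs n S) 0) = n -> attained_on_central F N &
      exists2 rho : R, 0 < rho <= rho0 &
        \forall l \near (0 : 'rV[R]_m * 'rV[R]_(nu - 2)),
          (Niso (F ^~ l) `](- rho)%R, rho[ <= N%:R%:E)%E].
Proof.
move=> N; set L := ('rV[R]_m * 'rV[R]_(nu - 2))%type in S d F V0 V0_nbhs F_def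
  S_smooth d_smooth S_flat c_def d0_neq0 N *.
have nu2 : (2 <= nu)%N by lia.
have nc : 0 < `|c| by rewrite normr_gt0.
have Sn : dqn n S 0 = n`!%:R * c.
  have [U [oU U0] CS] := S_smooth.
  rewrite c_def mulrC divfK ?pnatr_eq0 -?lt0n ?fact_gt0//.
  by rewrite /dq (derive1n_slice oU CS (leqnSn n) U0).
(* The largest size, up to the factor 2, that [comb_oscillation] tolerates. *)
pose eta := `|c| / 2 ^+ n / n.+1%:R ^+ n / 2.
have eta0 : 0 < eta by rewrite !divr_gt0// exprn_gt0.
have etac : eta * n.+1%:R ^+ n < `|c| / 2 ^+ n.
  have -> : eta * n.+1%:R ^+ n = `|c| / 2 ^+ n / 2.
    by rewrite /eta mulrAC divfK// expf_neq0// pnatr_eq0.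
  by rewrite ltr_pdivrMr// ltr_pMr ?ltr1n// divr_gt0// exprn_gt0.
have eta2 : eta <= `|c| / 2.
  rewrite /eta ler_pM2r ?invr_gt0// -mulrA -invfM ler_pdivrMr.
    apply: ler_peMr; first exact: ltW.
    by apply: mulr_ege1; apply: exprn_ege1; rewrite ler1n.
  by rewrite mulr_gt0// exprn_gt0.
pose B := `|dqn 2 S 0| + 1.
have B0 : 0 < B by rewrite ltr_wpDl.
(* |d| stays above |d 0| / 2 = B eps, and [B] bounds the second derivative of S:
   this is what makes F' monotone on the steep part. *)
pose eps := `|d 0| / 2 / B.
have nd0 : 0 < `|d 0| by rewrite normr_gt0.
have eps0 : 0 < eps by rewrite !divr_gt0.
have [r [top [dl [r0 top0 dl0 wells]]]] := flat_confining_wells nu2 nu_even a_gt0 eps0.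
have [rho' [V' [rho'0 nV' dV' box']]] :=
  local_box n_ge2 S_smooth d_smooth d0_neq0 F_def Sn eta0.
pose V1 := V' `&` [set l : L | forall j, `|l.2 0 j| <= dl].
have nV1 : nbhs (0 : L) V1.
  apply: filterI => //.
  have nu_dl : nbhs (0 : 'rV[R]_(nu - 2)) [set u | `|u| <= dl].
    by apply/nbhs_ballP; exists dl => // u; rewrite -ball_normE /= sub0r normrN => /ltW.
  exists (setT, [set u | `|u| <= dl]); first by split => //; exact: filterT.
  by move=> l [_ /= ul] j; apply: le_trans ul; exact: row_coord_le.
pose rho1 := Num.min rho' top.
have rho10 : 0 < rho1 by rewrite lt_min rho'0.
have rho1t : rho1 <= top by rewrite ge_min lexx orbT.
have box q l : q \in `]- rho1, rho1[ -> V1 l ->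
      [/\ F q l = S (q, l) + d l * cap nu a q l.2,
          `|dqn n S (q, l) - n`!%:R * c| <= eta,
          `|dqn 2 S (q, l)| <= B &
          forall j, (j < n.+1)%N -> is_derive q 1
            (fun s : R => dqn j S (s, l)) (dqn j.+1 S (q, l))].
  have rr : rho1 <= rho' by rewrite ge_min lexx.
  by move=> qI [V'l _]; apply: (box' q l _ V'l); exact: sub_symmetric_itv qI.
have upper rho l : rho <= rho1 -> V1 l ->
    finite_set [set q | `]- rho, rho[%classic q /\ F q l = 0] /\
    (Niso (F ^~ l) `](- rho)%R, rho[ <= N%:R%:E)%E.
  move=> rr V1l; have [V'l ul] := V1l.
  have [dl0' dlb dlc] := sign_perturbation c (dV' l V'l) d0_neq0.
  have [lip coer] := wells l.2 ul.
  rewrite /N -dlc.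
  apply: (@cap_zero_bound R n nu a r top eps B rho (d l) c l.2
    (fun j z => dqn j S (z, l)) (F ^~ l)) => //.
  - exact: le_trans rr rho1t.
  - by rewrite /eps mulrC divfK ?gt_eqF.
  - move=> j jn z zI; have [_ _ _ dz] := box z l (sub_symmetric_itv rr zI) V1l.
    by apply: dz; exact: ltnW.
  - by move=> z zI; have [_ _ ? _] := box z l (sub_symmetric_itv rr zI) V1l.
  - move=> z zI; have [_ nz _ _] := box z l (sub_symmetric_itv rr zI) V1l.
    have -> : c * dqn n S (z, l) = n`!%:R * c ^+ 2 + c * (dqn n S (z, l) - n`!%:R * c).
      by ring.
    have h1 : `|c * (dqn n S (z, l) - n`!%:R * c)| <= `|c| * eta.
      by rewrite normrM ler_pM2l.
    have h2 : `|c| * eta <= `|c| * (`|c| / 2) by rewrite ler_pM2l.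
    have h3 : `|c| * `|c| <= n`!%:R * c ^+ 2.
      rewrite -normrM -expr2 ger0_norm ?sqr_ge0// ler_peMl ?sqr_ge0//.
      by rewrite ler1n fact_gt0.
    have h4 := ler_norm (- (c * (dqn n S (z, l) - n`!%:R * c))).
    rewrite normrN in h4; have h5 : 0 < `|c| * `|c| by rewrite mulr_gt0.
    move: h1 h2 h3 h4 h5; move: (c * (_ - _)) (_ * c ^+ 2) (`|c| * eta) => x1 x2 x3.
    by clear; lra.
  - by move=> z zI; have [? _ _ _] := box z l (sub_symmetric_itv rr zI) V1l.
pose rho2 := Num.min rho1 rho0.
have rho20 : 0 < rho2 by rewrite lt_min rho10.
have rho21 : rho2 <= rho1 by rewrite ge_min lexx.
have rho2r : rho2 <= rho0 by rewrite ge_min lexx orbT.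
split.
- rewrite /Cyc; apply: (@le_trans _ _
    (ereal_sup [set Niso (F ^~ l) `]-rho2, rho2[ | l in V0 `&` V1])).
    apply: ereal_inf_lbound; exists rho2, (V0 `&` V1); split => //.
    + by rewrite rho20.
    + exact: filterI.
  apply: ge_ereal_sup => _ [l [_ V1l] <-].
  by have [] := upper rho2 l rho21 V1l.
- move=> rk; rewrite /attained_on_central; near=> rho => V nV.
  have rp : 0 < rho by near: rho; exact: nbhs_right_gt.
  have rr : rho <= rho1 by near: rho; exact: nbhs_right_le.
  pose LL := 2 * (`|c| * 2 ^+ n + eta + 1) / `|d 0|.
  have LL0 : 0 < LL.
    by rewrite divr_gt0// mulr_gt0// !addr_gt0// mulr_gt0// exprn_gt0.
  have [qc qc0 capL] := cap0_superquadratic nu2 nu_even a_gt0 LL0.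
  pose q1 := Num.min (Num.min qc 1) (rho / 2).
  have q10 : 0 < q1 by rewrite !lt_min qc0 ltr01 divr_gt0.
  have q1c : q1 <= qc by rewrite /q1 !ge_min lexx.
  have q11 : q1 <= 1 by rewrite /q1 !ge_min lexx orbT.
  have q1r : q1 <= rho / 2 by rewrite /q1 ge_min lexx orbT.
  have nVp : nbhs (0 : 'rV[R]_m) [set p | V (p, 0) /\ V1 (p, 0)].
    have [[A A'] /= [nA nA'] AA'] := filterI nV nV1.
    by apply: filterS nA => p Ap; apply: (AA' (p, 0)); split => //; exact: nbhs_singleton.
  (* [q1] is fixed before the scale [e] of the small zeros, which may thus be taken
     small with respect to it. *)
  have [beta beta0 surj] := central_surjection S_smooth S_flat rk nVp.
  have [C C0 small] := comb_poly_coef_small R n.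
  pose e := Num.min (Num.min 1 (q1 / n.+1%:R)) (beta / (C * `|c| + 1)).
  have CC : 0 < C * `|c| + 1 by rewrite ltr_wpDl// mulr_ge0.
  have e0 : 0 < e by rewrite !lt_min ltr01 !divr_gt0.
  have e1 : e <= 1 by rewrite /e !ge_min lexx.
  have eq1 : n.+1%:R * e <= q1.
    by rewrite mulrC -ler_pdivlMr// /e !ge_min lexx orbT.
  have eb : (C * `|c| + 1) * e <= beta.
    by rewrite mulrC -ler_pdivlMr// /e ge_min lexx orbT.
  have [|p [Vp V1p] pE] := surj (fun j => c * (comb_poly n e)`_j).
    move=> j jn; rewrite normrM.
    have := small e e0 e1 j jn; rewrite -(ler_pM2l nc) => h.
    apply: le_trans h _; apply: le_trans eb.
    by rewrite mulrDl mul1r mulrA (mulrC `|c| C) lerDl ltW.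
  exists p => //.
  have V1l : V1 (p, 0) := V1p.
  have [fin bd] := upper rho (p, 0) rr V1l.
  have q1rho : q1 < rho.
    by apply: le_lt_trans q1r _; rewrite ltr_pdivrMr// ltr_pMr// ltr1n.
  have ner := le_lt_trans eq1 q1rho.
  have close z : z \in `]- rho, rho[ ->
      `|S (z, (p, 0)) - (c *: comb_poly n e).[z]| <= eta * `|z| ^+ n.
    apply: (@taylor_comparison R (- rho) rho eta n _ rp
      (fun j z => dqn j S (z, (p, 0)))).
    + by rewrite oppr_lt0.
    + move=> j jn t tI; have [_ _ _ dz] := box t (p, 0) (sub_symmetric_itv rr tI) V1l.
      by apply: dz; exact: ltnW.
    + by move=> j jn; rewrite pE// derivn_comb_poly0.
    + move=> t tI; have [_ nt _ _] := box t (p, 0) (sub_symmetric_itv rr tI) V1l.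
      by rewrite derivn_comb_poly.
  pose G z := S (z, (p, 0)) + d (p, 0) * cap nu a z 0.
  have GF z : z \in `]- rho, rho[ -> G z = F z (p, 0).
    by move=> zI; have [-> _ _ _] := box z (p, 0) (sub_symmetric_itv rr zI) V1l.
  have dG z : z \in `]- rho, rho[ -> derivable G z 1.
    move=> zI; have [_ _ _ /(_ 0%N isT) dz] := box z (p, 0) (sub_symmetric_itv rr zI) V1l.
    have [_ coer] := wells 0 V1l.2.
    have zt : z < top.
      move: zI; rewrite in_itv/= => /andP[_ z1].
      exact: lt_le_trans z1 (le_trans rr rho1t).
    have dc := is_derive_cap nu2 a_gt0 coer zt.
    have -> : G = (fun s => S (s, (p, 0))) + d (p, 0) *: (cap nu a ^~ 0) by [].
    by apply: derivableD; [|apply: derivableZ]; exact: ex_derive.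
  have [||x [xI xS x0]] := @comb_zeros R n N c e rho q1 G e0 ner dG.
  + move=> i iN; rewrite /G cap0_le0 ?mulr0 ?addr0//; last 2 first.
      exact: ltW.
      by rewrite oppr_le0 mulr_ge0 ?addr_ge0 ?invr_ge0// ltW.
    apply: (@comb_oscillation R n c eta e (fun z => S (z, (p, 0))) i e0 (ltW eta0)
      c_neq0 etac iN).
    apply: close; apply: mem_symmetric_itv.
    rewrite normrN ger0_norm; last by rewrite mulr_ge0 ?addr_ge0 ?invr_ge0// ltW.
    apply: le_lt_trans ner; apply: ler_wpM2r; [exact: ltW|exact: natr_half_le].
  + rewrite /N; case: ifPn => cd; first by left.
    right; split => //.
    have cd' : c * d 0 < 0 by rewrite lt_neqAle mulf_neq0//= leNgt.
    apply: (@cap_dominates R n c (d 0) (d (p, 0)) eta e q1 LL) => //.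
    * apply: le_trans eq1; apply: ler_wpM2r; first exact: ltW.
      by rewrite ler_nat.
    * exact: ltW.
    * by apply: dV'; case: V1l.
    * exact: capL.
    * by apply: close; apply: mem_symmetric_itv; rewrite gtr0_norm.
  apply: (Niso_eq bd fin xI xS) => i iN; change (F (x i) (p, 0) = 0).
  by rewrite -GF; [exact: x0|exact: xI].
- exists rho2; first by rewrite rho20.
  by apply: filterS nV1 => l V1l; have [] := upper rho2 l rho21 V1l.
Unshelve. all: by end_near. Qed.
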